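(* Suppose $\min\{d_1,\dots,d_{L-1}\}\ge \min\{d_0,d_L\}$. Then $\bm W=(\bm W_1,\dots,\bm W_L)\in\mathcal W_F$ if and only if there exist $\bm Q_l\in\mathcal O^{d_{l-1}}$ for $l=2,\dots,L$, $\bm O_i\in\mathcal O^{h_i}$ for $i\in[p_Y]$, $\bm O_{p_Y+1}\in\mathcal O^{d_0-r_Y}$, $\widehat{\bm O}_{p_Y+1}\in\mathcal O^{d_L-r_Y}$, and a vector $\bm\sigma\in\mathbb R^{r_Y}$ satisfying $$\sigma_i^{2L-1}-\sqrt{\lambda}\,y_i\,\sigma_i^{L-1}+\lambda\sigma_i=0,\quad \sigma_i\ge 0,\quad \forall i\in[r_Y],\qquad \lambda:=\prod_{l=1}^L\lambda_l,$$ such that, with $\bm\Sigma_l\in\mathbb R^{d_l\times d_{l-1}}$ the matrix whose top-left $r_Y\times r_Y$ block is $\mathrm{diag}(\bm\sigma)/\sqrt{\lambda_l}$ and all other entries zero ($l\in[L]$), $$\bm W_1=\bm Q_2\bm\Sigma_1\,\mathrm{BlkD}(\bm O_1,\dots,\bm O_{p_Y},\bm O_{p_Y+1})\,\bm V_Y^T,\qquad \bm W_l=\bm Q_{l+1}\bm\Sigma_l\bm Q_l^T\ (l=2,\dots,L-1),$$ $$\bm W_L=\bm U_Y\,\mathrm{BlkD}(\bm O_1^T,\dots,\bm O_{p_Y}^T,\widehat{\bm O}_{p_Y+1}^T)\,\bm\Sigma_L\bm Q_L^T.$$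
   Context: Let $L\ge2$ be an integer, $d_0,\dots,d_L$ positive integers, $\bm Y\in\mathbb R^{d_L\times d_0}$, and $\lambda_1,\dots,\lambda_L>0$. For $\bm W=(\bm W_1,\dots,\bm W_L)$ with $\bm W_l\in\mathbb R^{d_l\times d_{l-1}}$, define $F(\bm W)=\|\bm W_L\cdots\bm W_1-\bm Y\|_F^2+\sum_{l=1}^L\lambda_l\|\bm W_l\|_F^2$ and $\mathcal W_F=\{\bm W:\nabla F(\bm W)=\bm 0\}$. Let $d_{\min}=\min\{d_0,d_L\}$ and let $\bm Y=\bm U_Y\bm\Sigma_Y\bm V_Y^T$ be an SVD with $\bm U_Y\in\mathcal O^{d_L}$, $\bm V_Y\in\mathcal O^{d_0}$, and $\bm\Sigma_Y\in\mathbb R^{d_L\times d_0}$ having diagonal entries $y_1\ge\dots\ge y_{d_{\min}}\ge0$ and zeros elsewhere. Let $r_Y=\mathrm{rank}(\bm Y)$, let $p_Y$ be the number of distinct positive singular values, and let $0=s_0<s_1<\dots<s_{p_Y}=r_Y$ be indices with $y_{s_{k-1}+1}=\dots=y_{s_k}$ and $y_{s_k}>y_{s_k+1}$ for each $k\in[p_Y]$ (with $y_j=0$ for $j>r_Y$); $h_k=s_k-s_{k-1}$. $\mathcal O^{n}$ denotes the set of $n\times n$ orthogonal matrices and $\mathrm{BlkD}(\cdot)$ a block-diagonal matrix with the listed diagonal blocks. *)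

(* Defs.v *)
From HB Require Import structures.
From mathcomp Require Import all_boot all_order all_algebra.
From mathcomp Require Import all_classical all_reals all_analysis.
Set Implicit Arguments. Unset Strict Implicit. Unset Printing Implicit Defensive.
Import Order.TTheory GRing.Theory Num.Theory.
Local Open Scope ring_scope.

Section DeepLinear.
Variable R : realType.

Definition orthogonal_mx (n : nat) (A : 'M[R]_n) : Prop := A *m A^T = 1%:M.

Definition fnorm2 (m n : nat) (A : 'M[R]_(m, n)) : R :=
  \sum_(i < m) \sum_(j < n) A i j ^+ 2.

Variable d : nat -> nat.
(* Layers are indexed from 0: W k : 'M_(d (k+1), d k) is the paper's W_{k+1}. *)
Fixpoint prodW (W : forall k : nat, 'M[R]_(d k.+1, d k)) (k : nat) : 'M[R]_(d k, d 0) :=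
  match k with
  | 0 => 1%:M
  | k'.+1 => W k' *m prodW W k'
  end.

(* F(W) = ||W_L ... W_1 - Y||_F^2 + sum_l lambda_l ||W_l||_F^2,
   with lam k the paper's lambda_{k+1}. *)
Definition lossF (L : nat) (lam : nat -> R) (Y : 'M[R]_(d L, d 0))
  (W : forall k : nat, 'M[R]_(d k.+1, d k)) : R :=
  fnorm2 (prodW W L - Y) + \sum_(k < L) lam k * fnorm2 (W k).

(* nabla F(W) = 0: F is differentiable (a polynomial), and every directional
   derivative at W vanishes. Only the first L layers enter lossF. *)
Definition critical_point (L : nat) (lam : nat -> R) (Y : 'M[R]_(d L, d 0))
  (W : forall k : nat, 'M[R]_(d k.+1, d k)) : Prop :=
  forall D : forall k : nat, 'M[R]_(d k.+1, d k),
    let f := fun t : R => lossF lam Y (fun k => W k + t *: D k) in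
    derivable f 0 1 /\ derive1 f 0 = 0.
End DeepLinear.

Definition rdiag (R : ringType) (m n : nat) (s : nat -> R) : 'M[R]_(m, n) :=
  \matrix_(i < m, j < n) (if (i : nat) == j then s i else 0).

(* Indices i, j (0-based) lie in the same diagonal block of
   BlkD(O_1,...,O_{p_Y},O_{p_Y+1}): for i, j < r the blocks are the maximal
   runs of equal singular values (y is nonincreasing), and all indices >= r
   form the last block. *)
Definition sameblk (R : realType) (y : nat -> R) (r i j : nat) : bool :=
  if (i < r)%N && (j < r)%N then y i == y j else (r <= i)%N && (r <= j)%N.

(* P = BlkD(O_1,...,O_{p_Y},O_{p_Y+1}) with every O_k orthogonal, written out:
   P is orthogonal and vanishes outside the diagonal blocks. *)
Definition blkD_orth (R : realType) (y : nat -> R) (r n : nat) (P : 'M[R]_n) : Prop :=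
  orthogonal_mx P /\ (forall i j : 'I_n, ~~ sameblk y r i j -> P i j = 0).

(* Main.v *)
Require Import Defs.
From HB Require Import structures.
From mathcomp Require Import all_boot all_order all_algebra.
From mathcomp Require Import all_classical all_reals all_analysis.
From mathcomp Require Import ring lra zify.
Import Order.TTheory GRing.Theory Num.Theory.
Import numFieldNormedType.Exports.
Local Open Scope ring_scope.

(* With M = W_L ... W_1, stationarity gives the balance equations
   lambda_l W_l W_l^T = lambda_{l+1} W_{l+1}^T W_{l+1}, together with
   lambda_1 W_1^T W_1 = M^T Y - M^T M and lambda_L W_L W_L^T = Y M^T - M M^T.
   In the singular bases of Y (where Y becomes the diagonal matrix S) this makes
   M^T S and S M^T symmetric, so the Gram matrix G = M^T S - M^T M commutes with
   S^T S; it also vanishes outside the leading r_Y x r_Y block. A block-orthogonal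
   P diagonalises G, the entries being sigma^2. Starting from V P^T, the balance
   equations propagate this Gram matrix through the layers, and Householder
   reflections turn each W_l into Q_{l+1} Sigma_l Q_l^T. In the last layer there
   is no freedom left: the entries of G = M^T S - M^T M force the left factor
   U Ph^T, where Ph extends the leading block of P, and give the equation for
   sigma. Conversely, all the terms of the gradient become diagonal in these
   bases. *)

Set Implicit Arguments. Unset Strict Implicit. Unset Printing Implicit Defensive.

(** * Orthogonal and rectangular diagonal matrices *)

Section Orthogonal.
Variable R : realType.

Lemma orthogonal_mxTP n (A : 'M[R]_n) : orthogonal_mx A -> A^T *m A = 1%:M.
Proof. exact: mulmx1C. Qed.

Lemma orthogonal_mx1 n : orthogonal_mx (1%:M : 'M[R]_n).
Proof. by rewrite /orthogonal_mx trmx1 mulmx1. Qed.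

Lemma orthogonal_mxT n (A : 'M[R]_n) : orthogonal_mx A -> orthogonal_mx A^T.
Proof. by move=> A1; rewrite /orthogonal_mx trmxK orthogonal_mxTP. Qed.

Lemma orthogonal_mxM n (A B : 'M[R]_n) :
  orthogonal_mx A -> orthogonal_mx B -> orthogonal_mx (A *m B).
Proof.
by move=> A1 B1; rewrite /orthogonal_mx trmx_mul mulmxA -(mulmxA A) B1 mulmx1.
Qed.

Lemma orthogonal_mulKT m n (A : 'M[R]_n) (X : 'M[R]_(m, n)) :
  orthogonal_mx A -> X *m A *m A^T = X.
Proof. by move=> A1; rewrite -mulmxA A1 mulmx1. Qed.

Lemma orthogonal_mulTK m n (A : 'M[R]_n) (X : 'M[R]_(m, n)) :
  orthogonal_mx A -> X *m A^T *m A = X.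
Proof. by move=> A1; rewrite -mulmxA orthogonal_mxTP// mulmx1. Qed.

Lemma gram_eq0 m n (A : 'M[R]_(m, n)) j : (A^T *m A) j j = 0 ->
  forall i, A i j = 0.
Proof.
rewrite mxE => /eqP; rewrite psumr_eq0; last first.
  by move=> i _; rewrite mxE -expr2 sqr_ge0.
by move=> /allP h i; have := h i (mem_index_enum _); rewrite mxE mulf_eq0 orbb => /eqP.
Qed.

Lemma gram_ge0 m n (A : 'M[R]_(m, n)) j : 0 <= (A^T *m A) j j.
Proof. by rewrite mxE sumr_ge0// => i _; rewrite mxE -expr2 sqr_ge0. Qed.

(** The reflection along [w = v - t]. Equal norms give [w^T v = w^T w / 2], so [v] is sent to
    [v - w = t]. Fixing everything orthogonal to [w] is what allows such reflections to be
    chained. *)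
Lemma householder m (v t : 'cV[R]_m) : v^T *m v = t^T *m t ->
  exists2 H : 'M[R]_m, orthogonal_mx H &
    H *m v = t /\ forall x : 'cV[R]_m, (v - t)^T *m x = 0 -> H *m x = x.
Proof.
move=> vt; set w := v - t; have [w0|w0] := eqVneq w 0.
  exists 1%:M; first exact: orthogonal_mx1.
  by split=> [|x _]; rewrite mul1mx//; apply/eqP; rewrite -subr_eq0; apply/eqP.
set c := (w^T *m w) 0 0.
have wwE : w^T *m w = c%:M by rewrite [LHS]mx11_scalar.
have c0 : c != 0.
  apply: contra w0 => /eqP/gram_eq0 w0; apply/eqP/matrixP => i j.
  by rewrite (ord1 j) w0 mxE.
have tvE : t^T *m v = v^T *m t.
  by rewrite [LHS]mx11_scalar [RHS]mx11_scalar -[v in LHS]trmxK -trmx_mul mxE.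
have wT : w^T = v^T - t^T by rewrite raddfB.
have wv : w^T *m v = (c / 2)%:M.
  have : w^T *m w = 2 *: (w^T *m v).
    rewrite wT mulmxBl [in RHS]mulmxBl !mulmxBr vt tvE scaler_nat mulr2n.
    by rewrite opprB.
  rewrite wwE => /(congr1 (fun X : 'M[R]_1 => 2^-1 *: X)).
  by rewrite scalerA mulVf ?pnatr_eq0// scale1r scale_scalar_mx mulrC => <-.
set k := 2 / c; have kc : k * c = 2 by rewrite /k divfK.
exists (1%:M - k *: (w *m w^T)); last first.
  split; last first.
    by move=> x wx; rewrite mulmxBl mul1mx -scalemxAl -mulmxA wx mulmx0 scaler0 subr0.
  rewrite mulmxBl mul1mx -scalemxAl -mulmxA wv mul_mx_scalar scalerA mulrA kc.
  by rewrite divff ?pnatr_eq0// scale1r /w subKr.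
rewrite /orthogonal_mx; set H := _ - _.
have -> : H^T = H.
  apply/matrixP => i j; rewrite !mxE eq_sym !big_ord1 !mxE.
  by congr (_ - _ * _); rewrite mulrC.
rewrite /H mulmxBl mul1mx mulmxBr mulmx1 -scalemxAl -scalemxAr mulmxA -(mulmxA w).
rewrite wwE mul_mx_scalar -scalemxAl !scalerA kc mulr_natr mulr2n scalerDl.
by rewrite opprB addrK subrK.
Qed.

(* Column by column: the reflection that sends column [k] to [s k *: e_k]
   fixes the vectors [s j *: e_j] already obtained. *)
Lemma orthogonal_columns m n (B : 'M[R]_(m, n)) (s : nat -> R) :
  (forall i, (m <= i)%N -> s i = 0) ->
  B^T *m B = rdiag n n (fun i => s i ^+ 2) ->
  exists2 Q : 'M[R]_m, orthogonal_mx Q & B = Q *m rdiag m n s.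
Proof.
move=> s0 BB; set D : 'M[R]_(m, n) := rdiag m n s.
have DD : D^T *m D = B^T *m B.
  rewrite BB; apply/matrixP => i j; rewrite !mxE.
  under eq_bigr => k _ do rewrite !mxE.
  have [im|im] := ltnP i m; last first.
    rewrite big1 => [|k _]; last by rewrite (ltn_eqF (leq_trans (ltn_ord k) im)) mul0r.
    by rewrite s0// expr0n if_same.
  rewrite (bigD1 (Ordinal im))//= eqxx big1 ?addr0 => [|k ki]; last first.
    by rewrite -val_eqE/= in ki; rewrite (negPf ki) mul0r.
  by case: eqP => [_|]; rewrite ?mulr0// expr2.
suff /(_ n (leqnn n)) [Q Q1 QB] : forall k, (k <= n)%N ->
    exists2 Q : 'M[R]_m, orthogonal_mx Q &
      forall j : 'I_n, (j < k)%N -> Q *m col j B = col j D.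
  exists Q^T; first exact: orthogonal_mxT.
  have QBD : Q *m B = D.
    apply/matrixP => i j; have /colP/(_ i) := QB j (ltn_ord j).
    by rewrite !mxE => <-; apply: eq_bigr => l _; rewrite mxE.
  by rewrite -QBD mulmxA orthogonal_mxTP// mul1mx.
elim=> [_|k IH kn]; first by exists 1%:M; [exact: orthogonal_mx1|].
have [Q Q1 QB] := IH (ltnW kn).
have inner (A : 'M[R]_(m, n)) i j : (col i A)^T *m col j A = ((A^T *m A) i j)%:M.
  by rewrite [LHS]mx11_scalar !mxE; congr (_%:M); apply: eq_bigr => l _; rewrite !mxE.
have QQ i j : (Q *m col i B)^T *m (Q *m col j B) = ((B^T *m B) i j)%:M.
  by rewrite trmx_mul mulmxA orthogonal_mulTK// inner.
pose K := Ordinal kn.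
have [|H H1 [HK Hx]] := @householder m (Q *m col K B) (col K D).
  by rewrite QQ inner DD.
exists (H *m Q); first exact: orthogonal_mxM.
move=> j; rewrite ltnS leq_eqVlt => /orP[/eqP jk|jk].
  by rewrite -mulmxA (_ : j = K)//; exact/val_inj.
(* An earlier column is not disturbed: its inner products with [Q *m col K B] and with [col K D] are
   the same Gram entry by [DD], so it is orthogonal to their difference. *)
have := QQ K j; rewrite (QB _ jk) => QKj.
by rewrite -mulmxA (QB _ jk) Hx// raddfB/= mulmxBl QKj inner DD subrr.
Qed.

End Orthogonal.

(** * Algebra of rectangular diagonal matrices *)

Section Rdiag.
Variable R : nzRingType.

Lemma eq_rdiag m n (s t : nat -> R) :
  (forall i, (i < m)%N -> (i < n)%N -> s i = t i) ->
  rdiag m n s = rdiag m n t.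
Proof.
move=> st; apply/matrixP => i j; rewrite !mxE; case: eqP => // ij.
by rewrite st// ij.
Qed.

Lemma rdiagT m n (s : nat -> R) : (rdiag m n s)^T = rdiag n m s.
Proof.
by apply/matrixP => i j; rewrite !mxE eq_sym; case: eqP => // ->.
Qed.

(** Indices from [n] on are lost in the inner sum, so the expected entries there must already be
    zero. *)
Lemma rdiag_mul m n p (s t : nat -> R) :
  (forall i, (n <= i)%N -> (i < m)%N -> (i < p)%N -> s i * t i = 0) ->
  rdiag m n s *m rdiag n p t = rdiag m p (fun i => s i * t i).
Proof.
move=> st0; apply/matrixP => i j; rewrite !mxE.
under eq_bigr => k _ do rewrite !mxE.
have [lin|lin] := ltnP i n; last first.
  rewrite big1 => [|k _]; last by rewrite (gtn_eqF (leq_trans (ltn_ord k) lin)) mul0r.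
  by case: eqP => // ij; rewrite st0// ij.
rewrite (bigD1 (Ordinal lin))//= eqxx big1 ?addr0 => [|k ki].
  by case: eqP; rewrite ?mulr0.
by rewrite -val_eqE/= eq_sym in ki; rewrite (negPf ki) mul0r.
Qed.

Lemma scale_rdiag m n a (s : nat -> R) :
  a *: rdiag m n s = rdiag m n (fun i => a * s i).
Proof. by apply/matrixP => i j; rewrite !mxE; case: eqP; rewrite ?mulr0. Qed.

Lemma rdiagD m n (s t : nat -> R) :
  rdiag m n s + rdiag m n t = rdiag m n (fun i => s i + t i).
Proof. by apply/matrixP => i j; rewrite !mxE; case: eqP; rewrite ?addr0. Qed.

Lemma rdiagB m n (s t : nat -> R) :
  rdiag m n s - rdiag m n t = rdiag m n (fun i => s i - t i).
Proof. by apply/matrixP => i j; rewrite !mxE; case: eqP; rewrite ?subr0. Qed.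

Lemma rdiag1 n : rdiag n n (fun=> 1) = 1%:M :> 'M[R]_n.
Proof. by apply/matrixP => i j; rewrite !mxE -val_eqE; case: eqP. Qed.

End Rdiag.

(** The matrix factors as [rdiag m m t *m pid_mx k], where [t] replaces the values of [s] from [k]
    on by 1 and so gives an invertible factor. *)
Lemma mxrank_rdiag (F : fieldType) m n k (s : nat -> F) :
  (k <= minn m n)%N -> (forall i, (i < minn m n)%N -> (s i != 0) = (i < k)%N) ->
  \rank (rdiag m n s) = k.
Proof.
rewrite leq_min => /andP[km kn] sk.
pose t i : F := if (i < k)%N then s i else 1.
have -> : rdiag m n s = rdiag m m t *m pid_mx k.
  have -> : pid_mx k = rdiag m n (fun i => (i < k)%:R) :> 'M[F]_(m, n).
    by apply/matrixP => i j; rewrite !mxE; case: eqP.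
  rewrite rdiag_mul => [|i im]; last by rewrite ltnNge im.
  apply: eq_rdiag => i im lin; rewrite /t.
  have := sk i; rewrite leq_min im lin => /(_ isT).
  by case: (i < k)%N => [_|/negbFE/eqP->]; rewrite ?mulr1 ?mulr0.
have t0 i : t i != 0.
  rewrite /t; case: ifP => [ik|_]; last exact: oner_neq0.
  by rewrite sk// leq_min !(leq_trans ik).
have /mulmx1_unit[tu _] : rdiag m m t *m rdiag m m (fun i => (t i)^-1) = 1%:M.
  rewrite rdiag_mul => [|i im]; last by rewrite ltnNge im.
  by rewrite -rdiag1; apply: eq_rdiag => i _ _; rewrite divff.
by rewrite eqmxMfull ?row_full_unit// rank_pid_mx.
Qed.

Section RdiagEntries.
Variable R : nzRingType.

(** The indices [j] and [j'] have the same value in different ordinal types. When the diagonal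
    factor is zero no such [j'] is required, see [mulmx_rdiag_eq0]. *)
Lemma mulmx_rdiagE p m n (A : 'M[R]_(p, m)) (s : nat -> R) i (j : 'I_n) (j' : 'I_m) :
  j' = j :> nat -> (A *m rdiag m n s) i j = A i j' * s j.
Proof.
move=> j'j; rewrite mxE (bigD1 j')//= mxE j'j eqxx big1 ?addr0// => k kj.
by rewrite mxE -j'j val_eqE (negPf kj) mulr0.
Qed.

Lemma mulmx_rdiag_eq0 p m n (A : 'M[R]_(p, m)) (s : nat -> R) i (j : 'I_n) :
  s j = 0 -> (A *m rdiag m n s) i j = 0.
Proof.
move=> sj; rewrite mxE big1// => k _; rewrite mxE.
by case: eqP => [->|]; rewrite ?sj mulr0.
Qed.

Lemma rdiag_mulmxE p m n (A : 'M[R]_(m, p)) (s : nat -> R) (i : 'I_n) j (i' : 'I_m) :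
  i' = i :> nat -> (rdiag n m s *m A) i j = s i * A i' j.
Proof.
move=> i'i; rewrite mxE (bigD1 i')//= mxE i'i eqxx big1 ?addr0// => k ki.
by rewrite mxE -i'i val_eqE eq_sym (negPf ki) mul0r.
Qed.

Lemma rdiag_mulmx_eq0 p m n (A : 'M[R]_(m, p)) (s : nat -> R) (i : 'I_n) j :
  s i = 0 -> (rdiag n m s *m A) i j = 0.
Proof.
move=> si; rewrite mxE big1// => k _; rewrite mxE.
by case: eqP => [_|]; rewrite ?si mul0r.
Qed.

End RdiagEntries.

(** * Block diagonalisation of symmetric matrices *)

Section Spectral.
Variable R : realType.

Lemma continuous_sum (T : topologicalType) (I : Type) (r : seq I) (P : pred I)
    (f : I -> T -> R) :
  (forall i, P i -> continuous (f i)) -> continuous (fun x => \sum_(i <- r | P i) f i x).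
Proof.
move=> cf; rewrite (_ : (fun x => _) = \sum_(i <- r | P i) f i); last first.
  by apply/funext => x; rewrite fct_sumE.
by apply: (big_ind (fun g : T -> R => continuous g)) => // [|g h cg ch] x;
  [exact: cst_continuous|exact: continuousD (cg x) (ch x)].
Qed.

Lemma continuous_mul (T : topologicalType) (f g : T -> R) :
  continuous f -> continuous g -> continuous (fun x => f x * g x).
Proof. by move=> cf cg x; exact: continuousM (cf x) (cg x). Qed.

Lemma continuous_mulmx_coord (T : topologicalType) m n p
    (A : T -> 'M[R]_(m, n)) (B : T -> 'M[R]_(n, p)) :
  (forall i j, continuous (fun x => A x i j)) ->
  (forall i j, continuous (fun x => B x i j)) ->
  forall i j, continuous (fun x => (A x *m B x) i j).
Proof.
move=> cA cB i j; under eq_fun do rewrite mxE.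
apply: (@continuous_sum _ _ _ _ (fun k x => A x i k * B x k j)) => k _.
exact: (continuous_mul (cA i k) (cB k j)).
Qed.

Lemma continuous_trmx_coord (T : topologicalType) m n (A : T -> 'M[R]_(m, n)) :
  (forall i j, continuous (fun x => A x i j)) ->
  forall i j, continuous (fun x => (A x)^T i j).
Proof.
move=> cA i j; rewrite (_ : (fun x => _) = fun x => A x j i); first exact: cA.
by apply/funext => x; rewrite mxE.
Qed.

Lemma continuous_vec_mx_coord m n i j :
  continuous (fun x : 'rV[R]_(m * n) => vec_mx x i j).
Proof. by under eq_fun do rewrite mxE; exact: coord_continuous. Qed.

(* Doubling the angle, [(c, s)] is chosen so that [(c ^+ 2 - s ^+ 2, 2 c s)] is
   proportional to [(a - e, 2 b)]. *)
Lemma jacobi_rotation (a b e : R) : b != 0 ->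
  exists c s : R, c ^+ 2 + s ^+ 2 = 1 /\
    a ^+ 2 + e ^+ 2 < (c ^+ 2 * a + 2 * c * s * b + s ^+ 2 * e) ^+ 2
                    + (s ^+ 2 * a - 2 * c * s * b + c ^+ 2 * e) ^+ 2.
Proof.
move=> b0; set u := a - e; set v := 2 * b.
have v20 : 0 < v ^+ 2 by rewrite exprn_even_gt0//= mulf_neq0// pnatr_eq0.
have uv0 : 0 < u ^+ 2 + v ^+ 2 by rewrite ltr_wpDl// sqr_ge0.
set r := Num.sqrt (u ^+ 2 + v ^+ 2).
have r0 : 0 < r by rewrite sqrtr_gt0.
have rE : r ^+ 2 = u ^+ 2 + v ^+ 2 by rewrite sqr_sqrtr// ltW.
(* Since [b] is nonzero, [r] exceeds [|u|] strictly; hence [r + u] and [c] are positive and [s] may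
   divide by [c]. *)
have ur : `|u| < r.
  by rewrite -sqrtr_sqr ltr_sqrt// ltrDl.
have uN : 0 < r + u by move: ur; rewrite ltr_norml; lra.
set c := Num.sqrt ((r + u) / (2 * r)).
have c0 : 0 < c by rewrite sqrtr_gt0 divr_gt0// mulr_gt0.
have cE : c ^+ 2 = (r + u) / (2 * r) by rewrite sqr_sqrtr// ltW// divr_gt0// mulr_gt0.
set s := v / (2 * r * c).
have r_n0 : r != 0 by rewrite gt_eqF.
have c_n0 : c != 0 by rewrite gt_eqF.
have sE : s ^+ 2 = (r - u) / (2 * r).
  have -> : s ^+ 2 = v ^+ 2 / (4 * r ^+ 2 * c ^+ 2) by rewrite /s; field; rewrite r_n0 c_n0.
  have -> : v ^+ 2 = (r + u) * (r - u) by rewrite mulrC -subr_sqr rE addrC addKr.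
  by rewrite cE; field; rewrite r_n0 gt_eqF.
have csE : 2 * c * s = v / r by rewrite /s; field; rewrite r_n0 c_n0.
exists c, s; split; first by rewrite cE sE; field.
rewrite csE cE sE.
have -> : (r + u) / (2 * r) * a + v / r * b + (r - u) / (2 * r) * e
   = (a + e + r) / 2.
  rewrite [RHS](_ : _ = ((a + e) * r + r ^+ 2) / (2 * r)); last by field.
  by rewrite rE /u /v; field.
have -> : (r - u) / (2 * r) * a - v / r * b + (r + u) / (2 * r) * e
   = (a + e - r) / 2.
  rewrite [RHS](_ : _ = ((a + e) * r - r ^+ 2) / (2 * r)); last by field.
  by rewrite rE /u /v; field.
(* The new diagonal entries are [(a + e + r) / 2] and [(a + e - r) / 2]. The sum is still [a + e],
   so the squares gain as soon as the gap [r] is larger than [|a - e|]. *)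
have : (a - e) ^+ 2 < r ^+ 2 by rewrite rE /u ltrDl.
by nra.
Qed.

(** The set is closed as the zero set of [f], the sum of the squares of all its defining equations,
    and bounded because rows of norm 1 have entries in [[-1, 1]]. Matrices are flattened to row
    vectors so that compactness of a box applies; [lab] encodes the blocks. *)
Lemma orthogonal_compact n (T : eqType) (lab : 'I_n -> T) :
  compact [set x : 'rV[R]_(n * n) | orthogonal_mx (vec_mx x) /\
    forall i j, lab i != lab j -> vec_mx x i j = 0]%classic.
Proof.
pose f (x : 'rV[R]_(n * n)) := fnorm2 (vec_mx x *m (vec_mx x)^T - 1%:M) +
  \sum_(i < n) \sum_(j < n | lab i != lab j) vec_mx x i j ^+ 2.
have fcont : continuous f.
  have cc := @continuous_vec_mx_coord n n.
  have c1 : continuous (fun x : 'rV[R]_(n * n) => fnorm2 (vec_mx x *m (vec_mx x)^T - 1%:M)).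
    do 2!(apply: continuous_sum => ? _).
    suff cB i j : continuous (fun x : 'rV[R]_(n * n) => (vec_mx x *m (vec_mx x)^T - 1%:M) i j).
      by apply: continuous_mul.
    rewrite (_ : (fun x => _) = (fun x : 'rV[R]_(n * n) => (vec_mx x *m (vec_mx x)^T) i j)
       + cst (- (1%:M : 'M[R]_n) i j)); last by apply/funext => x; rewrite [LHS]mxE [X in _ + X]mxE.
    move=> x; apply: continuousD; last exact: cst_continuous.
    by apply: (continuous_mulmx_coord (cc) (continuous_trmx_coord cc)).
  have c2 : continuous (fun x : 'rV[R]_(n * n) =>
      \sum_(i < n) \sum_(j < n | lab i != lab j) vec_mx x i j ^+ 2).
    by do 2!(apply: continuous_sum => ? _); apply: continuous_mul; exact: cc.
  by move=> x; exact: continuousD (c1 x) (c2 x).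
have sq_ge0 (I : finType) (P : pred I) (F : I -> R) : 0 <= \sum_(i | P i) F i ^+ 2.
  by apply: sumr_ge0 => i _; exact: sqr_ge0.
have f0 x : (f x = 0) <-> (orthogonal_mx (vec_mx x) /\
    forall i j, lab i != lab j -> vec_mx x i j = 0).
  split=> [/eqP|[x1 xlab]]; last first.
    rewrite /f /fnorm2 x1 subrr !big1 ?addr0// => i _.
      by rewrite big1 // => j ij; rewrite xlab// expr0n.
    by rewrite big1 // => j _; rewrite mxE expr0n.
  rewrite paddr_eq0 ?sumr_ge0// !psumr_eq0// => /andP[/allP h1 /allP h2]; split.
    apply/eqP; rewrite -subr_eq0; apply/eqP/matrixP => i j.
    have := h1 i (mem_index_enum _); rewrite psumr_eq0 => [|k _]; last exact: sqr_ge0.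
    by move=> /allP/(_ j (mem_index_enum _)); rewrite sqrf_eq0 => /eqP ->; rewrite mxE.
  move=> i j ij.
  have := h2 i (mem_index_enum _); rewrite psumr_eq0 => [|k _]; last exact: sqr_ge0.
  by move=> /allP/(_ j (mem_index_enum _)); rewrite ij sqrf_eq0 => /eqP.
apply: (@subclosed_compact _ _
  [set v : 'rV[R]_(n * n) | forall i, v ord0 i \in `[-1, 1]%R]%classic).
- rewrite (_ : mkset _ = f @^-1` [set x | x = 0])%classic; last first.
    by apply/seteqP; split => x /= /f0.
  by apply: preimage_closed => //; exact: closed_eq.
- have := @rV_compact R (n * n) (fun=> `[(- 1), 1]%classic).
  by apply => _; exact: segment_compact.
move=> x [x1 _] k; case/mxvec_indexP: k => i j.
have <- : vec_mx x i j = x ord0 (mxvec_index i j) by rewrite mxE.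
have : (vec_mx x *m (vec_mx x)^T) i i = 1 by rewrite x1 mxE eqxx.
rewrite mxE (bigD1 j)//= [_^T _ _]mxE -expr2 => e1.
have : vec_mx x i j ^+ 2 <= 1.
  by rewrite -e1 lerDl sumr_ge0// => l _; rewrite [_^T _ _]mxE -expr2 sqr_ge0.
by rewrite in_itv/= -ler_norml -sqrtr_sqr -{2}sqrtr1 ler_sqrt.
Qed.

(** [J] is the rotation in the plane of coordinates [p] and [q]. The support condition ensures that
    it respects any block structure with [p] and [q] in one block. *)
Lemma jacobi_matrix n (A : 'M[R]_n) (p q : 'I_n) (c s : R) :
  p != q -> A^T = A -> c ^+ 2 + s ^+ 2 = 1 ->
  exists J : 'M[R]_n, [/\ orthogonal_mx J,
    forall i j, J i j != 0 -> i = j \/ (i \in [:: p; q]) && (j \in [:: p; q]),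
    (J *m A *m J^T) p p = c ^+ 2 * A p p + 2 * c * s * A p q + s ^+ 2 * A q q,
    (J *m A *m J^T) q q = s ^+ 2 * A p p - 2 * c * s * A p q + c ^+ 2 * A q q &
    forall i, i != p -> i != q -> (J *m A *m J^T) i i = A i i].
Proof.
move=> pq AT cs.
pose e (i : 'I_n) : 'rV[R]_n := delta_mx 0 i.
pose r i := if i == p then c *: e p + s *: e q
            else if i == q then (- s) *: e p + c *: e q else e i.
pose J := \matrix_i r i.
(* Entries of [J *m X *m J^T] are values of the bilinear form of [X] on the rows of [J]: taking
   [X = A] gives the diagonal entries, taking [X = 1%:M] gives orthogonality. *)
pose bf (X : 'M[R]_n) (u v : 'rV[R]_n) := (u *m X *m v^T) 0 0.
have JX X i j : (J *m X *m J^T) i j = bf X (r i) (r j).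
  rewrite /bf -[r i](rowK r) -[r j](rowK r) -/J mxE [RHS]mxE.
  by apply: eq_bigr => k _; rewrite -row_mul !mxE.
have bfDl X u v w : bf X (u + v) w = bf X u w + bf X v w.
  by rewrite /bf !mulmxDl mxE.
have bfDr X u v w : bf X w (u + v) = bf X w u + bf X w v.
  by rewrite /bf raddfD/= mulmxDr mxE.
have bfZl X k u w : bf X (k *: u) w = k * bf X u w.
  by rewrite /bf -!scalemxAl mxE.
have bfZr X k u w : bf X w (k *: u) = k * bf X w u.
  by rewrite /bf linearZ/= -scalemxAr mxE.
have bfe X i j : bf X (e i) (e j) = X i j.
  by rewrite /bf -rowE trmx_delta -colE !mxE.
have qp : q == p = false by rewrite eq_sym (negPf pq).
have rp : r p = c *: e p + s *: e q by rewrite /r eqxx.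
have rq : r q = (- s) *: e p + c *: e q by rewrite /r qp eqxx.
have ri i : i != p -> i != q -> r i = e i by rewrite /r => /negPf -> /negPf ->.
have bfE := (bfDl, bfDr, bfZl, bfZr, bfe).
have Aqp : A q p = A p q by rewrite -[in LHS]AT mxE.
exists J; split.
- rewrite /orthogonal_mx (_ : J *m J^T = J *m 1%:M *m J^T); last by rewrite mulmx1.
  apply/matrixP => i j; rewrite JX.
  have [->|ip] := eqVneq i p; [|have [->|iq] := eqVneq i q];
  (have [->|jp] := eqVneq j p; [|have [->|jq] := eqVneq j q]);
  rewrite ?rp ?rq ?ri// !bfE !mxE ?eqxx ?(negPf pq) ?qp ?(negPf ip) ?(negPf iq) //=;
  rewrite ?(eq_sym p j) ?(eq_sym q j) ?(negPf jp) ?(negPf jq) /=;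
  first [ring | transitivity (c ^+ 2 + s ^+ 2); [ring | exact: cs]].
- move=> i j; rewrite mxE.
  have [->|ip] := eqVneq i p; [|have [->|iq] := eqVneq i q].
  + rewrite rp !mxE !inE !eqxx /=.
    case: (j == p) => /=; first by right.
    case: (j == q) => /=; first by right.
    by rewrite !mulr0 addr0 eqxx.
  + rewrite rq !mxE !inE !eqxx orbT /=.
    case: (j == p) => /=; first by right.
    case: (j == q) => /=; first by right.
    by rewrite !mulr0 addr0 eqxx.
  + rewrite ri// /e mxE eqxx /= (eq_sym j i); case: (i =P j) => [|_]; first by left.
    by rewrite eqxx.
- by rewrite JX rp !bfE Aqp; ring.
- by rewrite JX rq !bfE Aqp; ring.
- by move=> i ip iq; rewrite JX ri// bfe.
Qed.

(* A maximiser of the sum of the squared diagonal entries exists by compactness;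
   a Jacobi rotation would increase it if an off-diagonal entry were nonzero. *)
Lemma symmetric_diagonalisation n (T : eqType) (lab : 'I_n -> T) (G : 'M[R]_n) :
  G^T = G -> (forall i j, lab i != lab j -> G i j = 0) ->
  exists P : 'M[R]_n, [/\ orthogonal_mx P,
    forall i j, lab i != lab j -> P i j = 0 &
    forall i j, i != j -> (P *m G *m P^T) i j = 0].
Proof.
move=> GT Glab.
pose f (x : 'rV[R]_(n * n)) := \sum_(i < n) (vec_mx x *m G *m (vec_mx x)^T) i i ^+ 2.
have cf : continuous f.
  have cc := @continuous_vec_mx_coord n n.
  have cG : forall i j, continuous (fun x : 'rV[R]_(n * n) => G i j).
    by move=> i j; exact: cst_continuous.
  have c1 := continuous_mulmx_coord (continuous_mulmx_coord cc cG) (continuous_trmx_coord cc).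
  by apply: continuous_sum => i _; apply: continuous_mul; exact: c1.
have [||x] := @compact_EVT_max _ _ f _ _ (@orthogonal_compact _ _ lab).
- exists (mxvec 1%:M); rewrite /= mxvecK; split; first exact: orthogonal_mx1.
  by move=> i j; rewrite mxE; case: (eqVneq i j) => // ->; rewrite eqxx.
- by apply: continuous_subspaceT.
rewrite inE /=; set P := vec_mx x => -[P1 Plab] Pmax.
exists P; split => // p q pq; apply/eqP; apply: contraT => b0.
set A := P *m G *m P^T in b0.
have AT : A^T = A by rewrite /A !trmx_mul trmxK GT mulmxA.
(* [P] and [G] vanish off the blocks, hence so does [A]; a nonzero entry forces equal labels, and
   the rotation therefore stays in the compact set. *)
have labpq : lab p = lab q.
  apply/eqP; apply: contraNT b0 => pqlab; rewrite mxE big1// => k _.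
  have [kq|] := eqVneq (lab k) (lab q); last first.
    by move=> kq; rewrite [P^T _ _]mxE Plab ?mulr0// eq_sym.
  rewrite mxE big1 ?mul0r// => l _.
  have [lp|] := eqVneq (lab l) (lab p); last by move=> lp; rewrite Plab ?mul0r// eq_sym.
  by rewrite Glab ?mulr0// lp kq.
have [c [s [cs lt_ae]]] := @jacobi_rotation (A p p) (A p q) (A q q) b0.
have [J [J1 Jlab Jp Jq Ji]] := jacobi_matrix pq AT cs.
have /Pmax : mxvec (J *m P) \in [set x : 'rV[R]_(n * n) | orthogonal_mx (vec_mx x) /\
    forall i j, lab i != lab j -> vec_mx x i j = 0]%classic.
  rewrite inE /= mxvecK; split; first exact: orthogonal_mxM.
  move=> i j ij; rewrite mxE big1// => k _.
  have [->|Jik] := eqVneq (J i k) 0; first by rewrite mul0r.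
  suff ik : lab i = lab k by rewrite Plab ?mulr0// -ik.
  have [->//|] := Jlab _ _ Jik; rewrite !inE.
  by move=> /andP[/orP[]/eqP-> /orP[]/eqP->].
rewrite /f mxvecK trmx_mul.
have -> : J *m P *m G *m (P^T *m J^T) = J *m A *m J^T by rewrite /A !mulmxA.
rewrite leNgt => /negP[].
(* The rotation leaves the other diagonal entries unchanged, so the comparison reduces to the strict
   gain [lt_ae]. *)
rewrite (bigD1 p)//= (bigD1 q) 1?eq_sym//= [ltRHS](bigD1 p)//= [in ltRHS](bigD1 q) 1?eq_sym//=.
rewrite !addrA Jp Jq -/A; rewrite (eq_bigr (fun i => (J *m A *m J^T) i i ^+ 2)).
  by rewrite ltrD2r.
by move=> i /andP[ip iq]; rewrite Ji.
Qed.
End Spectral.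

(** * Block-orthogonal matrices attached to the level sets of the singular values *)

Section Blocks.
Variable R : realType.
Variables (y : nat -> R) (r : nat).
Hypothesis y_gt0 : forall i, (i < r)%N -> 0 < y i.

Let yr i := if (i < r)%N then y i else 0.

(** As [y] is positive below [r], the value 0 of [yr] labels exactly the last block. Blocks thus
    become level sets of one function, the form used for labels in the diagonalisation. *)
Lemma sameblkE i j : sameblk y r i j = (yr i == yr j).
Proof.
rewrite /sameblk /yr; case: (ltnP i r) => ir; case: (ltnP j r) => jr //=.
- by rewrite gt_eqF// y_gt0.
- by rewrite lt_eqF// y_gt0.
- by rewrite eqxx.
Qed.

(** Within a leading block [yr] is constant and [P] and [Ph] agree; mixed entries are zero; the
    possibly different last blocks are multiplied by zeros of [yr]. *)
Lemma blkD_mul_rdiag m n (P : 'M[R]_n) (Ph : 'M[R]_m) :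
  (r <= m)%N -> (r <= n)%N -> blkD_orth y r P -> blkD_orth y r Ph ->
  (forall (i j : 'I_n) (i' j' : 'I_m), (i < r)%N -> (j < r)%N ->
     i = i' :> nat -> j = j' :> nat -> P i j = Ph i' j') ->
  Ph *m rdiag m n yr = rdiag m n yr *m P.
Proof.
move=> rm rn [_ Pb] [_ Phb] PPh; apply/matrixP => i j.
have [ir|ir] := ltnP i r; have [jr|jr] := ltnP j r.
- rewrite (@mulmx_rdiagE _ _ _ _ _ _ _ _ (Ordinal (leq_trans jr rm)))//.
  rewrite (@rdiag_mulmxE _ _ _ _ _ _ _ _ (Ordinal (leq_trans ir rn)))//.
  rewrite (PPh _ _ i (Ordinal (leq_trans jr rm)))//.
  have [|ij] := boolP (sameblk y r i j); first by rewrite sameblkE => /eqP ->; rewrite mulrC.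
  by rewrite Phb// mul0r mulr0.
- rewrite mulmx_rdiag_eq0; last by rewrite /yr ltnNge jr.
  rewrite (@rdiag_mulmxE _ _ _ _ _ _ _ _ (Ordinal (leq_trans ir rn)))//.
  by rewrite Pb ?mulr0//= /sameblk ir (leq_gtF jr) /= leqNgt ir.
- rewrite rdiag_mulmx_eq0; last by rewrite /yr ltnNge ir.
  rewrite (@mulmx_rdiagE _ _ _ _ _ _ _ _ (Ordinal (leq_trans jr rm)))//.
  by rewrite Phb ?mul0r//= /sameblk jr (leq_gtF ir) /= ir leqNgt jr.
- rewrite mulmx_rdiag_eq0 ?rdiag_mulmx_eq0// /yr ltnNge ?ir ?jr//.
Qed.

(* With [E_k : 'M_(k, r)] the canonical inclusion and [P1] the leading [r x r]
   block of [P], the extension is [E_m P1 E_m^T + (1 - E_m E_m^T)]. *)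
Lemma blkD_extend m n (P : 'M[R]_n) :
  (r <= m)%N -> (r <= n)%N -> blkD_orth y r P ->
  exists2 Ph : 'M[R]_m, blkD_orth y r Ph &
    forall (i j : 'I_n) (i' j' : 'I_m), (i < r)%N -> (j < r)%N ->
     i = i' :> nat -> j = j' :> nat -> P i j = Ph i' j'.
Proof.
move=> rm rn [P1 Pb].
pose E k : 'M[R]_(k, r) := rdiag k r (fun=> 1).
pose pr k : 'M[R]_k := rdiag k k (fun i => (i < r)%:R).
have ET k : (E k)^T = rdiag r k (fun=> 1) by rewrite /E rdiagT.
have EE k : (r <= k)%N -> (E k)^T *m E k = 1%:M.
  move=> rk; rewrite ET rdiag_mul -?rdiag1; last first.
    by move=> i ki ir; rewrite ltnNge (leq_trans rk ki) in ir.
  by apply: eq_rdiag => i; rewrite mulr1.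
have prE k : E k *m (E k)^T = pr k.
  apply/matrixP => i j; have [ir|ir] := ltnP i r.
    by rewrite (@rdiag_mulmxE _ _ _ _ _ _ _ _ (Ordinal ir))// ET !mxE mul1r ir.
  rewrite !mxE (leq_gtF ir) if_same big1// => l _; rewrite !mxE gtn_eqF ?mul0r//.
  exact: leq_trans ir.
(* Nonzero entries of [P] have both indices on the same side of [r]. Commutation with the projection
   [pr n] then makes the leading block [B] orthogonal. *)
have prP : pr n *m P = P *m pr n.
  apply/matrixP => i j; rewrite (@rdiag_mulmxE _ _ _ _ _ _ _ _ i)//.
  rewrite (@mulmx_rdiagE _ _ _ _ _ _ _ _ j)//.
  have [->|Pij] := eqVneq (P i j) 0; first by rewrite mulr0 mul0r.
  suff -> : (i < r)%N = (j < r)%N.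
    by rewrite mulrC; case: (_ < _)%N; rewrite ?mulr0 ?mul0r ?mulr1 ?mul1r.
  have : sameblk y r i j by apply: contraTT isT => /Pb Pij0; rewrite Pij0 eqxx in Pij.
  by rewrite /sameblk; case: (ltnP i r) => _; case: (ltnP j r) => _.
pose B := (E n)^T *m P *m E n.
have B1 : B *m B^T = 1%:M.
  rewrite /B !trmx_mul trmxK !mulmxA -(mulmxA _ (E n)) prE -!mulmxA (mulmxA P) -prP.
  rewrite -!mulmxA (mulmxA P) P1 mul1mx -prE !mulmxA EE// mul1mx EE//.
have BE (i' j' : 'I_m) (i j : 'I_r) : i = i' :> nat -> j = j' :> nat ->
   (E m *m B *m (E m)^T) i' j' = B i j.
  move=> ii' jj'; rewrite ET (@mulmx_rdiagE _ _ _ _ _ _ _ _ j)// mulr1.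
  by rewrite (@rdiag_mulmxE _ _ _ _ _ _ _ _ i)// mul1r.
have BP (i j : 'I_n) (i' j' : 'I_r) : i' = i :> nat -> j' = j :> nat -> B i' j' = P i j.
  move=> ii' jj'; rewrite /B (@mulmx_rdiagE _ _ _ _ _ _ _ _ j)// mulr1.
  by rewrite ET (@rdiag_mulmxE _ _ _ _ _ _ _ _ i)// mul1r.
clearbody B.
exists (E m *m B *m (E m)^T + (1%:M - pr m)).
  split.
    have prT k : (pr k)^T = pr k by rewrite rdiagT.
    have prEE : pr m *m E m = E m by rewrite -prE -mulmxA EE// mulmx1.
    have Epr : (E m)^T *m pr m = (E m)^T by rewrite -prE mulmxA EE// mul1mx.
    have X : (E m *m B *m (E m)^T) *m (E m *m B *m (E m)^T)^T = pr m.
      rewrite !trmx_mul trmxK !mulmxA. rewrite -(mulmxA (E m *m B)) EE// mulmx1.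
      by rewrite -(mulmxA (E m)) B1 mulmx1 prE.
    have prpr : pr m *m pr m = pr m by rewrite -{2}prE mulmxA prEE prE.
    have Y : E m *m B *m (E m)^T *m (1%:M - pr m) = 0.
      by rewrite mulmxBr mulmx1 -(mulmxA (E m *m B)) Epr subrr.
    have Z : (1%:M - pr m) *m (1%:M - pr m) = 1%:M - pr m.
      by rewrite mulmxBr mulmx1 mulmxBl mul1mx prpr subrr subr0.
    have pT : (1%:M - pr m)^T = 1%:M - pr m by rewrite raddfB/= trmx1 prT.
    rewrite /orthogonal_mx raddfD/= mulmxDl !mulmxDr X pT Y Z.
    (* The second cross term is the transpose of the one in [Y], hence zero too. *)
    by rewrite -[X in _ + (X + _)]trmxK trmx_mul trmxK pT Y trmx0 addr0 add0r addrC subrK.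
  move=> i j ij; rewrite mxE; suff [-> ->] : (E m *m B *m (E m)^T) i j = 0 /\ (1%:M - pr m) i j = 0.
    by rewrite addr0.
  split; last first.
    rewrite !mxE -val_eqE; case: eqP => [e|_]; last by rewrite subr0.
    by move: ij; rewrite /sameblk e; case: ltnP => //=; rewrite eqxx.
  have [ir|ir] := ltnP i r; last first.
    rewrite -mulmxA mxE big1// => l _; rewrite mxE gtn_eqF ?mul0r//.
    exact: leq_trans ir.
  have [jr|jr] := ltnP j r; last first.
    rewrite mxE big1// => l _; rewrite ET [rdiag _ _ _ _ _]mxE ltn_eqF ?mulr0//.
    exact: leq_trans jr.
  rewrite (BE _ _ (Ordinal ir) (Ordinal jr))//.
  by rewrite (BP (Ordinal (leq_trans ir rn)) (Ordinal (leq_trans jr rn)))// Pb.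
move=> i j i' j' ir jr ii' jj'.
rewrite mxE (BE _ _ (Ordinal ir) (Ordinal jr))// (BP i j)//.
rewrite !mxE -val_eqE/= -jj' -ii' ir; case: eqP => _; rewrite ?subrr ?addr0//.
Qed.

(* Both [M^T S] and [S M^T] are symmetric, so [A^T A] commutes with the diagonal
   matrix [S^T S] and is therefore block diagonal. *)
Lemma gram_diagonalisation m n p q (M : 'M[R]_(m, n)) (A : 'M[R]_(p, n))
    (B : 'M[R]_(m, q)) :
  let S := rdiag m n yr in (r <= m)%N ->
  A^T *m A = M^T *m S - M^T *m M -> B *m B^T = S *m M^T - M *m M^T ->
  (forall (i : 'I_m) j, (r <= i)%N -> M i j = 0) /\
  exists P : 'M[R]_n, blkD_orth y r P /\
  exists2 st : nat -> R,
    (forall i, 0 <= st i) /\ (forall i, (r <= i)%N || (n <= i)%N -> st i = 0) &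
    P *m (A^T *m A) *m P^T = rdiag n n (fun i => st i ^+ 2).
Proof.
move=> S rm AA BB; set G := A^T *m A.
have MS : M^T *m S = G + M^T *m M by rewrite /G AA subrK.
have SM : S *m M^T = B *m B^T + M *m M^T by rewrite BB subrK.
(* By the hypotheses, [M^T S] and [S M^T] are sums of Gram matrices, hence symmetric. *)
have MSs : S^T *m M = M^T *m S.
  by rewrite -{1}[M]trmxK -trmx_mul MS !raddfD/= !trmx_mul !trmxK.
have SMs : M *m S^T = S *m M^T.
  by rewrite -{1}[M]trmxK -trmx_mul SM !raddfD/= !trmx_mul !trmxK.
have yr0 i : (r <= i)%N -> yr i = 0 by rewrite /yr ltnNge => ->.
(* The diagonal entries of [B B^T] and [M M^T] are nonnegative and add up to one of [S M^T], which
   is zero from row [r] on. *)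
have M0 (i : 'I_m) j : (r <= i)%N -> M i j = 0.
  move=> ri; rewrite -[M]trmxK mxE.
  suff : ((M^T)^T *m M^T) i i = 0 by move/gram_eq0.
  have : (B *m B^T + M *m M^T) i i = 0 by rewrite -SM rdiag_mulmx_eq0// yr0.
  rewrite mxE trmxK => /eqP; rewrite paddr_eq0 => [/andP[_ /eqP]//||].
    by rewrite -{1}[B]trmxK gram_ge0.
  by rewrite -{1}[M]trmxK gram_ge0.
split=> //.
have A0 i (j : 'I_n) : (r <= j)%N -> A i j = 0.
  move=> rj; suff : G j j = 0 by move/gram_eq0.
  have : (G + M^T *m M) j j = 0 by rewrite -MS mulmx_rdiag_eq0// yr0.
  by rewrite mxE => /eqP; rewrite paddr_eq0 ?gram_ge0// => /andP[/eqP].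
have comm : G *m (S^T *m S) = S^T *m S *m G.
  have e1 : M^T *m S *m (S^T *m S) = S^T *m M *m S^T *m S by rewrite -MSs !mulmxA.
  have e2 : S^T *m S *m (M^T *m S) = S^T *m M *m S^T *m S.
    by rewrite !mulmxA -(mulmxA S^T S) -SMs !mulmxA.
  have e3 : M^T *m M *m (S^T *m S) = M^T *m S *m (M^T *m S).
    by rewrite -!mulmxA (mulmxA M) SMs !mulmxA.
  have e4 : S^T *m S *m (M^T *m M) = M^T *m S *m (M^T *m S).
    by rewrite -MSs !mulmxA -(mulmxA S^T S) -SMs !mulmxA.
  by rewrite /G AA mulmxBl mulmxBr e1 e2 e3 e4.
have yr_ge0 i : 0 <= yr i by rewrite /yr; case: ifP => // /y_gt0/ltW.
(* An entry of [comm] reads [G i j * (yr j ^+ 2 - yr i ^+ 2) = 0] up to order, and squaring is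
   injective on the nonnegative values of [yr]. *)
have Glab (i j : 'I_n) : yr i != yr j -> G i j = 0.
  move=> yij; have := congr1 (fun X : 'M[R]_n => X i j) comm.
  have -> : S^T *m S = rdiag n n (fun i => yr i * yr i).
    by rewrite /S rdiagT rdiag_mul// => k mk _ _; rewrite yr0 ?mul0r// (leq_trans rm).
  rewrite (@mulmx_rdiagE _ _ _ _ _ _ _ _ j)// (@rdiag_mulmxE _ _ _ _ _ _ _ _ i)//.
  move=> /eqP; rewrite mulrC -subr_eq0 -mulrBl mulf_eq0 => /orP[|/eqP//].
  by rewrite subr_eq0 -!expr2 eqrXn2// eq_sym (negPf yij).
have [|P [P1 Plab Pd]] := @symmetric_diagonalisation R n R (fun i => yr i) G _ Glab.
  by rewrite /G trmx_mul trmxK.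
have Pb : blkD_orth y r P by split=> // i j; rewrite sameblkE; exact: Plab.
exists P; split=> //.
have PGE : P *m G *m P^T = (A *m P^T)^T *m (A *m P^T).
  by rewrite /G !trmx_mul trmxK !mulmxA.
(* [insub] extends the diagonal to all of [nat], with default 0 from [n] on. *)
pose st k := if insub k is Some i then Num.sqrt ((P *m G *m P^T) i i) else 0.
have stE (i : 'I_n) : st i = Num.sqrt ((P *m G *m P^T) i i) by rewrite /st valK.
exists st; first split.
- by move=> i; rewrite /st; case: insubP => [j _ _|//]; rewrite sqrtr_ge0.
- move=> i /orP[ri|ni]; rewrite /st; case: insubP => // j ij ji; last by rewrite ltnNge ni in ij.
  rewrite PGE mxE big1 ?sqrtr0// => k _.
  (* Columns of [A] from [r] on vanish, and [P] does not mix indices below [r] with the others. *)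
  suff -> : (A *m P^T) k j = 0 by rewrite mulr0.
  rewrite mxE big1// => l _; have [lr|lr] := ltnP l r; last by rewrite A0// mul0r.
  rewrite [P^T _ _]mxE Pb.2 ?mulr0// /sameblk lr ji (leq_gtF ri) /=.
  by rewrite ri leqNgt lr.
apply/matrixP => i j; rewrite [RHS]mxE; case: eqP => [/val_inj <-|/eqP ij]; last exact: Pd.
by rewrite stE sqr_sqrtr// PGE gram_ge0.
Qed.
End Blocks.

(** * The gradient *)

(** The type of the value varies with the index, so [x] is transported along [k = m]; at [m] the
    transport is trivial since equality proofs on [nat] are unique. *)
Lemma dependent_update (T : nat -> Type) (f : forall k, T k) m (x : T m) :
  exists g : forall k, T k, g m = x /\ forall k, k != m -> g k = f k.
Proof.
exists (fun k => if eqP : reflect (k = m) (k == m) is ReflectT e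
                 then eq_rect_r T x e else f k).
split=> [|k]; case: eqP => // e.
by rewrite (eq_irrelevance e erefl).
Qed.

Section Gradient.
Variable R : realType.

Lemma is_derive_fmul (f g : R -> R) x df dg :
  is_derive x (1 : R) f df -> is_derive x (1 : R) g dg ->
  is_derive x (1 : R) (fun t => f t * g t) (f x * dg + g x * df).
Proof. by move=> fx gx; exact: is_deriveM. Qed.

Lemma is_derive_fsum n (h : 'I_n -> R -> R) x (dh : 'I_n -> R) :
  (forall i, is_derive x (1 : R) (h i) (dh i)) ->
  is_derive x (1 : R) (fun t => \sum_(i < n) h i t) (\sum_(i < n) dh i).
Proof.
move=> hx; rewrite (_ : (fun t => _) = \sum_(i < n) h i); first exact: is_derive_sum.
by apply/funext => t; rewrite fct_sumE.
Qed.

(** Stated entrywise so that the scalar rules for sums and products suffice. *)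
Definition mx_is_derive m n (x : R) (f : R -> 'M[R]_(m, n)) (df : 'M[R]_(m, n)) :=
  forall i j, is_derive x (1 : R) (fun t => f t i j) (df i j).

Lemma mx_is_derive_cst m n x (A : 'M[R]_(m, n)) : mx_is_derive x (fun=> A) 0.
Proof. by move=> i j; rewrite mxE; exact: is_derive_cst. Qed.

Lemma mx_is_derive_line m n x (A B : 'M[R]_(m, n)) :
  mx_is_derive x (fun t => A + t *: B) B.
Proof.
move=> i j; rewrite (_ : (fun t => _) = cst (A i j) + (id * cst (B i j))).
  have dB := is_derive_fmul (is_derive_id x 1) (is_derive_cst (B i j) x 1).
  by apply: is_derive_eq (is_deriveD (is_derive_cst (A i j) x 1) dB) _; rewrite mulr0 mulr1 !add0r.
by apply/funext => t; rewrite !mxE.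
Qed.

Lemma mx_is_deriveB m n x (f : R -> 'M[R]_(m, n)) df A :
  mx_is_derive x f df -> mx_is_derive x (fun t => f t - A) df.
Proof.
move=> fx i j; rewrite (_ : (fun t => _) = (fun t => f t i j) + cst (- A i j)).
  by apply: is_derive_eq (is_deriveD (fx i j) (is_derive_cst _ _ _)) _; rewrite addr0.
by apply/funext => t; rewrite !mxE.
Qed.

Lemma mx_is_deriveM m n p x (f : R -> 'M[R]_(m, n)) (g : R -> 'M[R]_(n, p)) df dg :
  mx_is_derive x f df -> mx_is_derive x g dg ->
  mx_is_derive x (fun t => f t *m g t) (df *m g x + f x *m dg).
Proof.
move=> fx gx i j; rewrite (_ : (fun t => _) = fun t => \sum_k f t i k * g t k j); last first.
  by apply/funext => t; rewrite mxE.
rewrite !mxE -big_split/=.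
rewrite (eq_bigr (fun k => f x i k * dg k j + g x k j * df i k)) => [|k _]; last first.
  by rewrite addrC [g x k j * _]mulrC.
by apply: is_derive_fsum => k; exact: is_derive_fmul.
Qed.

Lemma fnorm2_trace m n (A : 'M[R]_(m, n)) : fnorm2 A = \tr (A^T *m A).
Proof.
rewrite /fnorm2 exchange_big/=; apply: eq_bigr => j _; rewrite mxE.
by apply: eq_bigr => i _; rewrite mxE expr2.
Qed.

Lemma fnorm2_eq0 m n (A : 'M[R]_(m, n)) : fnorm2 A = 0 -> A = 0.
Proof.
rewrite fnorm2_trace => /eqP; rewrite psumr_eq0 => [/allP A0|j _]; last exact: gram_ge0.
apply/matrixP => i j; rewrite mxE; apply: gram_eq0 i.
by apply/eqP/A0; exact: mem_index_enum.
Qed.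

Lemma fnorm2_ge0 m n (A : 'M[R]_(m, n)) : 0 <= fnorm2 A.
Proof. by rewrite fnorm2_trace sumr_ge0// => j _; exact: gram_ge0. Qed.

Lemma is_derive_fnorm2 m n x (f : R -> 'M[R]_(m, n)) df :
  mx_is_derive x f df ->
  is_derive x (1 : R) (fun t => fnorm2 (f t)) (2 * \tr ((f x)^T *m df)).
Proof.
move=> fx; have -> : 2 * \tr ((f x)^T *m df) =
    \sum_(i < m) \sum_(j < n) (f x i j * df i j + f x i j * df i j).
  rewrite exchange_big/= mulr_sumr; apply: eq_bigr => j _; rewrite mxE mulr_sumr.
  by apply: eq_bigr => i _; rewrite mxE; ring.
do 2!(apply: is_derive_fsum => ?).
exact: is_derive_fmul.
Qed.

Variable d : nat -> nat.
Implicit Types W D : forall k : nat, 'M[R]_(d k.+1, d k).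

(** Leibniz rule: the derivative of [prodW] at [W] in the direction [D]. *)
Fixpoint dprodW W D k : 'M[R]_(d k, d 0) :=
  if k is k'.+1 then D k' *m prodW W k' + W k' *m dprodW W D k' else 0.

Lemma mx_is_derive_prodW W D k :
  mx_is_derive 0 (fun t => prodW (fun j => W j + t *: D j) k) (dprodW W D k).
Proof.
elim: k => [|k IH] /=; first exact: mx_is_derive_cst.
have := mx_is_deriveM (mx_is_derive_line 0 (W k) (D k)) IH.
rewrite scale0r addr0 (_ : prodW (fun j => W j + 0 *: D j) k = prodW W k)//.
by elim: k {IH} => //= k ->; rewrite scale0r addr0.
Qed.

(* [Z k] is the residual [W_L ... W_1 - Y] pulled back by the layers above [k]. *)
Definition backprop L (Z : forall k, 'M[R]_(d k, d 0)) W :=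
  forall k, (k < L)%N -> Z k = (W k)^T *m Z k.+1.

(** Built downwards: the induction hypothesis is applied to [(W L)^T *m E], then the value at the
    new top index is set to [E]. *)
Lemma backprop_exists L W (E : 'M[R]_(d L, d 0)) :
  exists Z, Z L = E /\ backprop L Z W.
Proof.
elim: L E => [|L IH] E.
  have [Z [ZE _]] := dependent_update (fun k => 0 : 'M[R]_(d k, d 0)) E.
  by exists Z.
have [Z [ZL ZW]] := IH ((W L)^T *m E).
have [Z' [Z'E Z'Z]] := dependent_update Z E.
exists Z'; split=> // k; rewrite ltnS leq_eqVlt => /orP[/eqP->|kL].
  by rewrite Z'E Z'Z ?neq_ltn ?ltnSn// ZL.
have k1 : k != L.+1 by rewrite neq_ltn (ltn_trans kL).
have k2 : k.+1 != L.+1 by rewrite neq_ltn ltnS kL.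
by rewrite (Z'Z _ k1) (Z'Z _ k2) ZW.
Qed.

(** Adjoint form of the Leibniz rule: the layers above [k] are transposed and absorbed in [Z k.+1],
    and cyclicity of the trace isolates [D k]. *)
Lemma backprop_dprodW L Z W D : backprop L Z W ->
  \tr ((Z L)^T *m dprodW W D L) =
  \sum_(k < L) \tr ((Z k.+1 *m (prodW W k)^T)^T *m D k).
Proof.
elim: L => [|L IH] ZW /=; first by rewrite mulmx0 mxtrace0 big_ord0.
rewrite big_ord_recr/= mulmxDr raddfD/= addrC; congr (_ + _).
  by rewrite trmx_mul trmxK mulmxA mxtrace_mulC mulmxA.
rewrite -IH => [|k kL]; last by rewrite ZW// ltnW.
by rewrite (ZW L)// trmx_mul trmxK mulmxA.
Qed.

Lemma critical_pointP L (lam : nat -> R) (Y : 'M[R]_(d L, d 0)) W :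
  critical_point lam Y W <->
  exists Z, [/\ Z L = prodW W L - Y, backprop L Z W &
    forall k, (k < L)%N -> Z k.+1 *m (prodW W k)^T + lam k *: W k = 0].
Proof.
(* For the backpropagated residual [Z], this is half the gradient of the loss in layer [k]. *)
pose G (Z : forall k, 'M[R]_(d k, d 0)) k := Z k.+1 *m (prodW W k)^T + lam k *: W k.
have deriv Z D : Z L = prodW W L - Y -> backprop L Z W ->
    is_derive (0 : R) (1 : R) (fun t => lossF lam Y (fun k => W k + t *: D k))
      (2 * \sum_(k < L) \tr ((G Z k)^T *m D k)).
  move=> ZL ZW.
  have W0 : (fun k => W k + 0 *: D k) = W.
    by apply: functional_extensionality_dep => k; rewrite scale0r addr0.
  have d1 := is_derive_fnorm2 (mx_is_deriveB Y (@mx_is_derive_prodW W D L)).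
  have d2 : is_derive (0 : R) (1 : R) (fun t => \sum_(k < L) lam k * fnorm2 (W k + t *: D k))
      (\sum_(k < L) 2 * lam k * \tr ((W k)^T *m D k)).
    apply: is_derive_fsum => k.
    have := is_derive_fmul (is_derive_cst (lam k) (0 : R) 1)
      (is_derive_fnorm2 (mx_is_derive_line 0 (W k) (D k))).
    by rewrite scale0r addr0 mulr0 addr0 mulrCA mulrA.
  have := is_deriveD d1 d2; rewrite W0 -ZL backprop_dprodW// mulr_sumr -big_split/=.
  rewrite mulr_sumr; congr is_derive; apply: eq_bigr => k _.
  by rewrite /G raddfD/= mulmxDl raddfD/= linearZ/= -scalemxAl mxtraceZ mulrDr mulrA.
split=> [crit|[Z [ZL ZW ZG]] D f]; last first.
  have fD := deriv Z D ZL ZW; split; first exact: (@ex_derive _ _ _ _ _ _ _ fD).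
  rewrite derive1E (@derive_val _ _ _ _ _ _ _ fD) big1 ?mulr0// => k _.
  by rewrite /G ZG// trmx0 mul0mx mxtrace0.
have [Z [ZL ZW]] := backprop_exists W (prodW W L - Y).
exists Z; split=> // k kL.
(* With the gradient itself as direction, the derivative is twice a sum of squared norms, so every
   [G Z k] with [k < L] vanishes. *)
have [_] := crit (G Z); rewrite derive1E (@derive_val _ _ _ _ _ _ _ (deriv Z (G Z) ZL ZW)).
move=> /eqP; rewrite mulf_eq0 pnatr_eq0/= psumr_eq0 => [|j _]; last first.
  by rewrite -fnorm2_trace fnorm2_ge0.
move=> /allP/(_ (Ordinal kL) (mem_index_enum _))/=.
by rewrite -fnorm2_trace => /eqP/fnorm2_eq0.
Qed.

End Gradient.

(** * Critical points *)

Section Layers.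
Variables (R : realType) (d : nat -> nat).
Implicit Types W : forall k : nat, 'M[R]_(d k.+1, d k).
Variable lam : nat -> R.

(** Multiplying the stationarity equation of layer [k] by [(W k)^T] on the right, and that of layer
    [k.+1] by [(W k.+1)^T] on the left, produces the same matrix [- Z k.+1 *m (prodW W k.+1)^T]. At
    the two ends this matrix is expressed through the residual, using that [(prodW W k)^T *m Z k]
    does not depend on [k]. *)
Lemma critical_balance L (Y : 'M[R]_(d L.+1, d 0)) W :
  let M := prodW W L.+1 in
  critical_point lam Y W ->
  [/\ forall k, (k < L)%N -> lam k *: (W k *m (W k)^T) =
        lam k.+1 *: ((W k.+1)^T *m W k.+1),
      lam 0 *: ((W 0)^T *m W 0) = M^T *m Y - M^T *m M &
      lam L *: (W L *m (W L)^T) = Y *m M^T - M *m M^T].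
Proof.
move=> M /critical_pointP[Z [ZL ZW ZG]].
have lW k : (k < L.+1)%N -> lam k *: W k = - (Z k.+1 *m (prodW W k)^T).
  by move=> kL; apply/eqP; rewrite -addr_eq0 addrC ZG.
have WW k : (k < L.+1)%N -> lam k *: (W k *m (W k)^T) = - (Z k.+1 *m (prodW W k.+1)^T).
  by move=> kL; rewrite scalemxAl lW// mulNmx -mulmxA -trmx_mul.
have WTW k : (k < L.+1)%N -> lam k *: ((W k)^T *m W k) = - (Z k *m (prodW W k)^T).
  by move=> kL; rewrite scalemxAr lW// mulmxN mulmxA -ZW.
have Z0 k : (k <= L.+1)%N -> (prodW W k)^T *m Z k = Z 0.
  elim: k => [|k IH] kL /=; first by rewrite trmx1 mul1mx.
  by rewrite trmx_mul -mulmxA -ZW// IH// ltnW.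
split=> [k kL||].
- by rewrite WW ?WTW// ltnS ltnW.
- by rewrite WTW//= trmx1 mulmx1 -(Z0 L.+1)// ZL mulmxBr opprB.
- by rewrite WW// ZL mulmxBl opprB.
Qed.

(** The inner orthogonal factors cancel in pairs; the vanishing of [s k] beyond the width [d k]
    ensures that no layer truncates a nonzero entry. *)
Lemma prodW_diag W (Q : forall k, 'M[R]_(d k)) (s : nat -> nat -> R) L :
  (forall k, (k < L)%N -> orthogonal_mx (Q k)) -> orthogonal_mx (Q 0) ->
  (forall k, (k < L)%N -> W k = Q k.+1 *m rdiag (d k.+1) (d k) (s k) *m (Q k)^T) ->
  (forall k i, (k < L)%N -> (d k <= i)%N -> s k i = 0) ->
  prodW W L = Q L *m rdiag (d L) (d 0) (fun i => \prod_(j < L) s j i) *m (Q 0)^T.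
Proof.
elim: L => [|L IH] Q1 Q01 WE s0 /=.
  under eq_rdiag => i _ _ do rewrite big_ord0.
  by rewrite rdiag1 mulmx1 Q01.
rewrite IH//; try by move=> k *; (apply: Q1 || apply: WE || apply: s0) => //; rewrite ltnS ltnW.
rewrite WE// !mulmxA orthogonal_mulTK; last exact: Q1.
rewrite -(mulmxA (Q L.+1)) rdiag_mul; last by move=> i Li _ _; rewrite s0 ?mul0r.
by congr (_ *m _ *m _); apply: eq_rdiag => i _ _; rewrite big_ord_recr mulrC.
Qed.

(** Induction along the layers: the Gram matrix of [W m] in the basis [Q m] yields the left factor
    [Q m.+1], and the balance equation hands the same [st] to the next layer. Layer [m] itself is
    not factored yet, only its Gram matrix is known. *)
Lemma balanced_svd W (st : nat -> R) m (Q0 : 'M[R]_(d 0)) :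
  (forall k, (k <= m)%N -> 0 < lam k) ->
  (forall k i, (k <= m)%N -> (d k <= i)%N -> st i = 0) ->
  (forall k, (k < m)%N -> lam k *: (W k *m (W k)^T) =
        lam k.+1 *: ((W k.+1)^T *m W k.+1)) ->
  orthogonal_mx Q0 ->
  lam 0 *: (Q0^T *m ((W 0)^T *m W 0) *m Q0) = rdiag (d 0) (d 0) (fun i => st i ^+ 2) ->
  exists Q : forall k, 'M[R]_(d k), [/\ Q 0 = Q0,
    forall k, (k <= m)%N -> orthogonal_mx (Q k),
    forall k, (k < m)%N -> W k = Q k.+1 *m
      rdiag (d k.+1) (d k) (fun i => st i * (Num.sqrt (lam k))^-1) *m (Q k)^T &
    lam m *: ((Q m)^T *m ((W m)^T *m W m) *m Q m) = rdiag (d m) (d m) (fun i => st i ^+ 2)].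
Proof.
elim: m => [|m IH] lam0 st0 bal Q01 gram.
  have [Q [QE _]] := @dependent_update (fun k => 'M[R]_(d k)) (fun k => 0) 0 Q0.
  by exists Q; split=> // [k|]; rewrite ?leqn0 ?QE// => /eqP ->; rewrite QE.
have [] := IH _ _ _ Q01 gram.
- by move=> k km; exact: lam0 (leqW km).
- by move=> k i km; exact: st0 (leqW km).
- by move=> k km; exact: bal (ltnW km).
move=> Q [QE Q1 WE Qm].
have lm0 : 0 < lam m by exact: lam0.
set B := Num.sqrt (lam m) *: (W m *m Q m).
have sq k : (k <= m.+1)%N -> Num.sqrt (lam k) * Num.sqrt (lam k) = lam k.
  by move=> km; rewrite -expr2 sqr_sqrtr// ltW// lam0.
have BB : B^T *m B = rdiag (d m) (d m) (fun i => st i ^+ 2).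
  rewrite /B [(_ *: _)^T]linearZ/= -scalemxAl -scalemxAr scalerA sq// -Qm trmx_mul.
  by rewrite !mulmxA.
have [|Q' Q'1 BE] := @orthogonal_columns R _ _ B st _ BB.
  by move=> i; exact: st0.
have [Qn [Qn' QnE]] := @dependent_update (fun k => 'M[R]_(d k)) Q m.+1 Q'.
have QnQ k : (k <= m)%N -> Qn k = Q k by move=> km; rewrite QnE// neq_ltn ltnS km.
have Wm : W m = Q' *m rdiag (d m.+1) (d m) (fun i => st i * (Num.sqrt (lam m))^-1) *m (Q m)^T.
  under eq_rdiag => i _ _ do rewrite mulrC.
  rewrite -scale_rdiag -scalemxAr -BE /B scalerA mulVf ?gt_eqF ?sqrtr_gt0// scale1r.
  by rewrite orthogonal_mulKT//; exact: Q1.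
exists Qn; split.
- by rewrite QnQ.
- move=> k; rewrite leq_eqVlt => /orP[/eqP ->|km]; first by rewrite Qn'.
  by rewrite QnQ//; exact: Q1.
- move=> k; rewrite ltnS leq_eqVlt => /orP[/eqP ->|km]; first by rewrite Qn' QnQ.
  by rewrite !QnQ ?WE// ltnW.
have Qm1 : orthogonal_mx (Q m) by exact: Q1.
have lmV : lam m * ((Num.sqrt (lam m))^-1 * (Num.sqrt (lam m))^-1) = 1.
  by rewrite -invfM sq ?divff ?gt_eqF// leqW.
(* Balance replaces the Gram matrix of layer [m.+1] by [W m *m (W m)^T], which is diagonal in the
   basis [Q']. *)
rewrite Qn' scalemxAl scalemxAr -bal// Wm.
rewrite !trmx_mul trmxK !mulmxA orthogonal_mulTK// -scalemxAr -scalemxAl.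
rewrite -!mulmxA (mulmxA Q'^T) orthogonal_mxTP// mul1mx mulmx1.
rewrite rdiagT rdiag_mul => [|i mi _ _]; last by rewrite (st0 m)// !mul0r.
rewrite scale_rdiag; apply: eq_rdiag => i _ _.
by rewrite /= -[RHS]mulr1 -lmV; ring.
Qed.

Lemma prod_invsqrt L : (forall j, (j < L)%N -> 0 < lam j) ->
  \prod_(j < L) (Num.sqrt (lam j))^-1 = (Num.sqrt (\prod_(j < L) lam j))^-1.
Proof.
elim: L => [|L IH] lam0; first by rewrite !big_ord0 sqrtr1 invr1.
rewrite !big_ord_recr/= IH => [|j jL]; last by rewrite lam0// ltnW.
by rewrite -invfM sqrtrM// prodr_ge0// => j _; apply/ltW/lam0; exact: leqW.
Qed.

Lemma prod_layers (t : R) L :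
  \prod_(j < L) (t * (Num.sqrt (lam j))^-1) = t ^+ L * \prod_(j < L) (Num.sqrt (lam j))^-1.
Proof. by rewrite big_split/= prodr_const card_ord. Qed.

(** The product over all layers except [k], written as the full product with the factor of layer [k]
    divided out. *)
Lemma prod_other_layers (t : R) L k : (k < L)%N -> 0 < lam k ->
  (\prod_(k.+1 <= j < L) (t * (Num.sqrt (lam j))^-1)) *
    \prod_(j < k) (t * (Num.sqrt (lam j))^-1) =
  t ^+ L.-1 * (Num.sqrt (lam k) * \prod_(j < L) (Num.sqrt (lam j))^-1).
Proof.
move=> kL lk; pose a j := (Num.sqrt (lam j))^-1.
have -> : \prod_(j < L) (Num.sqrt (lam j))^-1 =
    (\prod_(j < k) a j) * (a k * \prod_(k.+1 <= j < L) a j).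
  by rewrite -(big_mkord xpredT a) (@big_cat_nat _ _ _ k) ?(ltnW kL)//= big_mkord -big_ltn.
rewrite !big_split/= prodr_const_nat prodr_const card_ord.
have -> : L.-1 = (L - k.+1 + k)%N by lia.
rewrite exprD -/(a _); set u := \prod_(_ <= _ < _) _; set v := \prod_(_ < _) _.
rewrite -[Num.sqrt _](invrK (Num.sqrt (lam k))) -/(a k).
by field; rewrite /a invr_eq0 gt_eqF ?sqrtr_gt0.
Qed.

(** In the bases [Q] the product, the residual and its pullbacks are all diagonal, so each gradient
    entry is a scalar expression; for every layer it is a nonzero multiple of the equation for
    [st]. *)
Lemma diag_critical n W (Q : forall k, 'M[R]_(d k)) (st y : nat -> R) :
  let L := n.+2 in
  let lambda := \prod_(k < L) lam k in
  (forall k, (k < L)%N -> 0 < lam k) ->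
  (forall k, (k <= L)%N -> orthogonal_mx (Q k)) ->
  (forall k, (k < L)%N -> W k = Q k.+1 *m
     rdiag (d k.+1) (d k) (fun i => st i * (Num.sqrt (lam k))^-1) *m (Q k)^T) ->
  (forall k i, (k <= L)%N -> (d k <= i)%N -> st i = 0) ->
  (forall i, st i ^+ (2 * L - 1) - Num.sqrt lambda * y i * st i ^+ (L - 1)
           + lambda * st i = 0) ->
  critical_point lam (Q L *m rdiag (d L) (d 0) y *m (Q 0)^T) W.
Proof.
move=> L lambda lam0 Q1 WE st0 eqn; apply/critical_pointP.
pose s k i := st i * (Num.sqrt (lam k))^-1.
have s0 k l i : (l <= L)%N -> (d l <= i)%N -> s k i = 0.
  by move=> lL li; rewrite /s (st0 l)// mul0r.
have PE k : (k <= L)%N ->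
    prodW W k = Q k *m rdiag (d k) (d 0) (fun i => \prod_(j < k) s j i) *m (Q 0)^T.
  move=> kL; apply: prodW_diag => [j jk||j jk|j i jk].
  - by apply: Q1; rewrite (leq_trans (ltnW jk)).
  - exact: Q1.
  - by apply: WE; rewrite (leq_trans jk).
  - by apply: s0; rewrite (leq_trans (ltnW jk)).
pose e i := \prod_(j < L) s j i - y i.
exists (fun k => Q k *m rdiag (d k) (d 0) (fun i => (\prod_(k <= j < L) s j i) * e i) *m (Q 0)^T).
split=> [|k kL|k kL].
- rewrite PE// -mulmxBl -mulmxBr rdiagB; congr (_ *m _ *m _).
  by apply: eq_rdiag => i _ _; rewrite big_geq// mul1r.
- rewrite WE// !trmx_mul trmxK !mulmxA rdiagT orthogonal_mulTK; last exact: Q1.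
  rewrite -[in RHS](mulmxA (Q k)) rdiag_mul => [|i ki _ _]; last first.
    by rewrite [X in X * _](s0 _ k.+1) ?mul0r.
  congr (_ *m _ *m _); apply: eq_rdiag => i _ _.
  by rewrite [in LHS]big_ltn// mulrA.
rewrite PE ?(ltnW kL)// !trmx_mul trmxK rdiagT !mulmxA orthogonal_mulTK; last exact: Q1.
(* Entries beyond [d 0] carry the factor [st i ^+ L.-1], which is zero there because [L.-1 = n.+1]
   is positive. *)
rewrite -(mulmxA (Q k.+1)) rdiag_mul; last first.
  move=> i i0 _ _; rewrite mulrAC prod_other_layers ?lam0// (st0 0)//.
  by rewrite expr0n/= !mul0r.
rewrite WE// scalemxAl scalemxAr -mulmxDl -mulmxDr scale_rdiag rdiagD.
rewrite (_ : rdiag _ _ _ = 0) ?mulmx0 ?mul0mx//; apply/matrixP => i j.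
rewrite !mxE; case: eqP => // _.
rewrite mulrAC prod_other_layers ?lam0// /e prod_layers prod_invsqrt//.
have l0 : 0 < lambda by apply: prodr_gt0 => l _; exact: lam0.
have := eqn i; rewrite -/lambda; set c := Num.sqrt lambda; set a := Num.sqrt (lam k).
have -> : lambda = c ^+ 2 by rewrite sqr_sqrtr// ltW.
have -> : lam k = a ^+ 2 by rewrite sqr_sqrtr// ltW// lam0.
have c0 : c != 0 by rewrite gt_eqF ?sqrtr_gt0.
have a0 : a != 0 by rewrite gt_eqF ?sqrtr_gt0 ?lam0.
rewrite (_ : (2 * L - 1 = L + L.-1)%N); last by rewrite /L; lia.
rewrite subn1 exprD => H.
(* The factor [c ^+ 2 / a] clears the denominators and turns the gradient entry into the left side
   of [H]. *)
suff : (c ^+ 2 / a) * (st i ^+ L.-1 * (a / c) * (st i ^+ L / c - y i) +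
   a ^+ 2 * (st i / a)) = 0.
  by move=> /eqP; rewrite mulf_eq0 mulf_eq0 invr_eq0 (negPf a0) sqrf_eq0 (negPf c0) => /eqP.
by rewrite -[RHS]H; field; rewrite a0 c0.
Qed.

(** The Gram matrix determines [C] only up to a left orthogonal factor. Where [st j] is nonzero, the
    equation with [q] kills the off-diagonal entries of column [j] in rows below [r] and makes the
    diagonal one positive, so the column norm fixes it as [st j]; where [st j] is zero, the whole
    column vanishes. *)
Lemma diagonal_factor m k n (C : 'M[R]_(m, k)) (st p q y : nat -> R) r :
  (r <= m)%N -> (r <= n)%N -> (r <= k)%N ->
  (forall i, 0 <= st i) -> (forall i, (r <= i)%N -> st i = 0) ->
  (forall i, (i < r)%N -> 0 < y i) ->
  (forall i, st i != 0 -> 0 < p i /\ 0 < q i) ->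
  C^T *m C = rdiag k k (fun i => st i ^+ 2) ->
  (forall (i : 'I_m) j, (r <= i)%N -> (C *m rdiag k n p) i j = 0) ->
  (C *m rdiag k n p)^T *m rdiag m n y = rdiag n n q ->
  C = rdiag m k st.
Proof.
move=> rm rn rk st_ge0 st0 y0 pq CC Cr Cq; apply/matrixP => i j; rewrite mxE.
have [sj|sj] := eqVneq (st j) 0.
  rewrite (gram_eq0 (j := j)) ?CC; last by rewrite mxE eqxx sj expr0n.
  by case: eqP => // ->; rewrite sj.
have jr : (j < r)%N by rewrite ltnNge; apply: contra sj => /st0 ->.
have [pj qj] := pq _ sj.
pose jn := Ordinal (leq_trans jr rn); pose jm := Ordinal (leq_trans jr rm).
have CE b : (C *m rdiag k n p) b jn = C b j * p j by rewrite (@mulmx_rdiagE _ _ _ _ _ _ _ _ j).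
have off (b : 'I_m) : b != j :> nat -> C b j = 0.
  move=> bj; apply/eqP; rewrite -(mulIr_eq0 _ (mulIf (lt0r_neq0 pj))) -CE.
  have [br|rb] := ltnP b r; last by rewrite Cr.
  have := congr1 (fun X : 'M[R]_n => X jn (Ordinal (leq_trans br rn))) Cq.
  rewrite (@mulmx_rdiagE _ _ _ _ _ _ _ _ b)// [RHS]mxE/= eq_sym (negPf bj) mxE.
  by move=> /eqP; rewrite mulf_eq0 (gt_eqF (y0 _ br)) orbF.
have diag : 0 < C jm j.
  have := congr1 (fun X : 'M[R]_n => X jn jn) Cq.
  rewrite (@mulmx_rdiagE _ _ _ _ _ _ _ _ jm)// [RHS]mxE/= eqxx mxE CE => H.
  by move: qj; rewrite -H pmulr_lgt0 ?y0// pmulr_lgt0.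
have [ij|/eqP] := eqP; last exact: off.
have -> : i = jm by exact/val_inj.
have := congr1 (fun X : 'M[R]_k => X j j) CC.
rewrite [RHS]mxE eqxx mxE (bigD1 jm)//= big1 ?addr0 => [|b bj]; last first.
  by rewrite [C b j]off ?mulr0// -val_eqE.
by rewrite mxE -expr2 => /eqP; rewrite eqrXn2// ?ltW// => /eqP ->.
Qed.

End Layers.

(** Sorted nonnegative values have their nonzero ones first; [k] is the position of the first zero,
    and orthogonal factors preserve the rank. *)
Lemma rank_nonincreasing_svd (R : realType) m n (U : 'M[R]_m) (V : 'M[R]_n) (y : nat -> R) :
  orthogonal_mx U -> orthogonal_mx V ->
  (forall i j, (i <= j < minn m n)%N -> y j <= y i) ->
  (forall i, (i < minn m n)%N -> 0 <= y i) ->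
  let r := \rank (U *m rdiag m n y *m V^T) in
  (r <= minn m n)%N /\ forall i, (i < minn m n)%N -> (y i != 0) = (i < r)%N.
Proof.
move=> U1 V1 ymono y_ge0 /=.
pose k := find (fun i => y i == 0) (iota 0 (minn m n)).
have kmin : (k <= minn m n)%N by rewrite -[leqRHS](size_iota 0) find_size.
have yk i : (i < minn m n)%N -> (y i != 0) = (i < k)%N.
  move=> imin; have [ik|ki] := ltnP i k.
    by have := before_find 0%N ik; rewrite nth_iota// add0n => /negbT.
  have km : (k < minn m n)%N by exact: leq_ltn_trans imin.
  have : has (fun i => y i == 0) (iota 0 (minn m n)) by rewrite has_find size_iota.
  move=> /(nth_find 0%N); rewrite -/k nth_iota// add0n => /eqP yk0.
  by apply/negbTE; rewrite negbK eq_le y_ge0// -yk0 ymono// ki.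
suff -> : \rank (U *m rdiag m n y *m V^T) = k by [].
have [Uu _] := mulmx1_unit U1; have [_ Vu] := mulmx1_unit V1.
rewrite mxrankMfree ?row_free_unit// eqmxMfull ?row_full_unit//.
exact: mxrank_rdiag.
Qed.

(** * The two implications, with the singular values of [Y] cut off at [r] *)

Section Characterisation.
Variables (R : realType) (n : nat) (d : nat -> nat) (lam : nat -> R).
Variables (U : 'M[R]_(d n.+2)) (V : 'M[R]_(d 0)) (y : nat -> R) (r : nat).
Let L := n.+2.
Let lambda := \prod_(k < L) lam k.
Let yr i := if (i < r)%N then y i else 0.
Let S : 'M[R]_(d L, d 0) := rdiag (d L) (d 0) yr.
Let Y := U *m S *m V^T.
Hypothesis lam_gt0 : forall k, (k < L)%N -> 0 < lam k.
Hypothesis U1 : orthogonal_mx U.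
Hypothesis V1 : orthogonal_mx V.
Hypothesis y_gt0 : forall i, (i < r)%N -> 0 < y i.
Hypothesis r_le : forall k, (k <= L)%N -> (r <= d k)%N.
Variable W : forall k : nat, 'M[R]_(d k.+1, d k).

(* [st] is the paper's sigma, extended by 0 from index [r] on. *)
Definition aligned_factors (Q : forall k : nat, 'M[R]_(d k)) (P : 'M[R]_(d 0))
    (Ph : 'M[R]_(d L)) (st : nat -> R) :=
  [/\ forall k, (1 <= k <= n.+1)%N -> orthogonal_mx (Q k),
      blkD_orth y r P, blkD_orth y r Ph &
      forall (i j : 'I_(d 0)) (i' j' : 'I_(d L)), (i < r)%N -> (j < r)%N ->
        i = i' :> nat -> j = j' :> nat -> P i j = Ph i' j'] /\
  [/\ forall i, 0 <= st i, forall i, (r <= i)%N -> st i = 0,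
      forall i, st i ^+ (2 * L - 1) - Num.sqrt lambda * yr i * st i ^+ (L - 1)
           + lambda * st i = 0 &
      let Sig k := rdiag (d k.+1) (d k) (fun i => st i * (Num.sqrt (lam k))^-1) in
      [/\ W 0%N = Q 1%N *m Sig 0%N *m P *m V^T,
          forall k, (1 <= k <= n)%N -> W k = Q k.+1 *m Sig k *m (Q k)^T &
          W n.+1 = U *m Ph^T *m Sig n.+1 *m (Q n.+1)^T]].

Lemma aligned_factors_critical Q P Ph st :
  aligned_factors Q P Ph st -> critical_point lam Y W.
Proof.
move=> [[Q1 Pb Phb PPh] [st_ge0 st0 eqn /= [W0 Wk WL]]].
(* The outer bases absorb the block factors: [V *m P^T] at index 0 and [U *m Ph^T] at index [L]. [Y]
   keeps its form because [Ph *m S = S *m P]. *)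
have [Q' [Q'0 Q'Q]] := @dependent_update (fun k => 'M[R]_(d k)) Q 0 (V *m P^T).
have [T [TL TQ']] := @dependent_update (fun k => 'M[R]_(d k)) Q' L (U *m Ph^T).
have T0 : T 0 = V *m P^T by rewrite TQ'// Q'0.
have TQ k : (1 <= k <= n.+1)%N -> T k = Q k.
  by move=> /andP[k0 kn]; rewrite TQ' ?Q'Q// ?neq_ltn ?k0 ?orbT// ltnS kn.
have -> : Y = T L *m S *m (T 0)^T.
  rewrite TL T0 trmx_mul trmxK /Y mulmxA -!(mulmxA U); congr (_ *m (_ *m _)).
  rewrite -mulmxA -(@blkD_mul_rdiag _ _ _ y_gt0 _ _ P Ph) ?r_le//.
  by rewrite mulmxA orthogonal_mxTP ?mul1mx//; case: Phb.
apply: (@diag_critical _ _ lam n W T st yr) => //.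
- move=> k; case: k => [_|k kL].
    by rewrite T0; apply: orthogonal_mxM => //; apply: orthogonal_mxT; case: Pb.
  have [->|kL'] := eqVneq k.+1 L.
    by rewrite TL; apply: orthogonal_mxM => //; apply: orthogonal_mxT; case: Phb.
  have kn : (1 <= k.+1 <= n.+1)%N by move: kL kL'; rewrite /L; lia.
  by rewrite TQ//; exact: Q1.
- move=> k; case: k => [_|k kL].
    by rewrite TQ// T0 W0 trmx_mul trmxK !mulmxA.
  have [[->]|kL'] := eqVneq k.+1 n.+1.
    by rewrite -/L TL TQ ?leqnn// WL.
  have kn : (1 <= k.+1 <= n)%N by move: kL kL'; rewrite /L; lia.
  by rewrite Wk// !TQ//= ?(leqW kn)//.
- by move=> k i kL /(leq_trans (r_le kL)); exact: st0.
Qed.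

Lemma critical_aligned_factors : critical_point lam Y W ->
  exists Q P Ph st, aligned_factors Q P Ph st.
Proof.
move=> /critical_balance; set M := prodW W n.+2 => -[bal gr0 grL].
pose Mh := U^T *m M *m V.
(* [A] and [B] are the end layers in the singular bases of [Y], scaled so that the end balance
   equations lose their weights. *)
pose A := Num.sqrt (lam 0) *: (W 0 *m V).
set l := Num.sqrt (lam n.+1); pose B := l *: (U^T *m W n.+1).
have sq k : (k < L)%N -> Num.sqrt (lam k) * Num.sqrt (lam k) = lam k.
  by move=> km; rewrite -expr2 sqr_sqrtr// ltW// lam_gt0.
have l0 : 0 < l by rewrite sqrtr_gt0 lam_gt0.
have AA : A^T *m A = Mh^T *m S - Mh^T *m Mh.
  rewrite /A [(_ *: _)^T]linearZ/= -scalemxAl -scalemxAr scalerA sq//.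
  rewrite trmx_mul !mulmxA -(mulmxA V^T) scalemxAl scalemxAr gr0 mulmxBr mulmxBl.
  rewrite /Mh !trmx_mul trmxK /Y !mulmxA orthogonal_mulTK//.
  by rewrite (orthogonal_mulKT _ U1).
have BB : B *m B^T = S *m Mh^T - Mh *m Mh^T.
  rewrite /B [(_ *: _)^T]linearZ/= -scalemxAl -scalemxAr scalerA sq//.
  rewrite trmx_mul trmxK !mulmxA -(mulmxA U^T) scalemxAl scalemxAr grL mulmxBr mulmxBl.
  rewrite /Mh !trmx_mul trmxK /Y !mulmxA orthogonal_mxTP// mul1mx.
  by rewrite (orthogonal_mulKT _ V1).
have [Mh0 [P [Pb [st [st_ge0 st0] PAP]]]] := gram_diagonalisation y_gt0 (r_le (leqnn L)) AA BB.
have [Ph Phb PPh] := blkD_extend (r_le (leqnn L)) (r_le (leq0n L)) Pb.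
have PhS : Ph *m S = S *m P by apply: blkD_mul_rdiag; rewrite ?r_le.
have [P1 _] := Pb; have [Ph1 Phz] := Phb.
have st0r i : (r <= i)%N -> st i = 0 by move=> ri; apply: st0; rewrite ri.
have Q01 : orthogonal_mx (V *m P^T) by apply: orthogonal_mxM => //; exact: orthogonal_mxT.
have [|||||Q [Q0 Q1 WE grQ]] := @balanced_svd R d lam W st n.+1 (V *m P^T).
- by move=> k kn; exact: lam_gt0.
- by move=> k i kn /(leq_trans (r_le (leqW kn))); exact: st0r.
- by move=> k kn; exact: bal.
- exact: Q01.
- have -> : rdiag (d 0) (d 0) (fun i => st i ^+ 2) = P *m (A^T *m A) *m P^T by [].
  have -> : A^T *m A = lam 0 *: ((W 0 *m V)^T *m (W 0 *m V)).
    by rewrite /A [(_ *: _)^T]linearZ/= -scalemxAl -scalemxAr scalerA sq.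
  by rewrite -scalemxAr -scalemxAl !trmx_mul trmxK !mulmxA.
pose p i := \prod_(j < n.+1) (st i * (Num.sqrt (lam j))^-1).
have ME : M *m (V *m P^T) = W n.+1 *m Q n.+1 *m rdiag (d n.+1) (d 0) p.
  rewrite (_ : M = W n.+1 *m prodW W n.+1)//.
  rewrite (@prodW_diag _ _ W Q (fun j i => st i * (Num.sqrt (lam j))^-1))//.
  - by rewrite Q0 -[LHS]mulmxA (orthogonal_mulTK _ Q01) mulmxA.
  - by move=> k kn; exact: Q1 (ltnW kn).
  - by rewrite Q0.
  - by move=> k i kn /(leq_trans (r_le (leqW (ltnW kn)))) /st0r ->; rewrite mul0r.
(* The last layer in its expected bases; the goal for it is [C = rdiag (d L) (d n.+1) st], which
   leaves no further rotation on the left. *)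
pose C := l *: (Ph *m U^T *m W n.+1 *m Q n.+1).
have CC : C^T *m C = rdiag (d n.+1) (d n.+1) (fun i => st i ^+ 2).
  rewrite /C [(_ *: _)^T]linearZ/= -scalemxAl -scalemxAr scalerA sq// -grQ; congr (_ *: _).
  rewrite !trmx_mul trmxK !mulmxA orthogonal_mulTK//.
  by rewrite (orthogonal_mulKT _ U1).
pose X := Ph *m Mh *m P^T.
have CX : C *m rdiag (d n.+1) (d 0) p = l *: X.
  by rewrite /C -scalemxAl -!mulmxA (mulmxA (W _)) -ME /X /Mh !mulmxA.
(* Obtained from [X^T S = rdiag (st ^+ 2) + X^T X] (see [XS]): replace [X] by
   [l^-1 *: (C *m rdiag p)] in [X^T X] and multiply by [l]. *)
pose q i := l * st i ^+ 2 + l^-1 * (p i ^+ 2 * st i ^+ 2).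
have CS : (C *m rdiag (d n.+1) (d 0) p)^T *m S = rdiag (d 0) (d 0) q.
  have XX : X^T *m X = (l ^- 2) *: rdiag (d 0) (d 0) (fun i => p i ^+ 2 * st i ^+ 2).
    have -> : X = l^-1 *: (C *m rdiag (d n.+1) (d 0) p).
      by rewrite CX scalerA mulVf ?scale1r// gt_eqF.
    rewrite [(_ *: _)^T]linearZ/= -scalemxAl -scalemxAr scalerA -expr2 exprVn; congr (_ *: _).
    rewrite trmx_mul mulmxA -(mulmxA _ C^T) CC rdiagT.
    have p0 i : (d n.+1 <= i)%N -> st i = 0 by move/(leq_trans (r_le (leqnSn _))); exact: st0r.
    rewrite rdiag_mul => [|i /p0 -> _ _]; last by rewrite expr0n mulr0.
    rewrite rdiag_mul => [|i /p0 -> _ _]; last by rewrite expr0n mulr0 mul0r.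
    by apply: eq_rdiag => i _ _; rewrite mulrAC expr2.
  have PhTS : Ph^T *m S = S *m P^T.
    rewrite -[LHS](orthogonal_mulKT _ P1) -[_ *m S *m P]mulmxA -PhS.
    by rewrite mulmxA orthogonal_mxTP// mul1mx.
  have XS : X^T *m S = rdiag (d 0) (d 0) (fun i => st i ^+ 2) + X^T *m X.
    rewrite -PAP AA mulmxBr mulmxBl /X !trmx_mul trmxK !mulmxA.
    rewrite (orthogonal_mulTK _ Ph1) subrK -[LHS]mulmxA PhTS.
    by rewrite !mulmxA.
  rewrite CX [(_ *: _)^T]linearZ/= -scalemxAl XS XX scalerDr scalerA !scale_rdiag rdiagD.
  by apply: eq_rdiag => i _ _; rewrite /q; congr (_ + _ * _); field; rewrite gt_eqF.
have st_p i : st i != 0 -> 0 < p i.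
  move=> sti; apply: prodr_gt0 => j _; rewrite mulr_gt0 ?lt0r ?sti ?st_ge0//.
  by rewrite -lt0r invr_gt0 sqrtr_gt0 lam_gt0// leqW.
have CE : C = rdiag (d L) (d n.+1) st.
  apply: (diagonal_factor (r_le (leqnn L)) (r_le (leq0n L)) (r_le (leqnSn _))
    st_ge0 st0r _ _ CC _ CS).
  - by move=> i ir; rewrite /yr ir y_gt0.
  - move=> i sti; split; first exact: st_p.
    rewrite /q; apply: ltr_pwDl; first by rewrite mulr_gt0// exprn_gt0// lt0r sti st_ge0.
    by rewrite mulr_ge0 ?invr_ge0 ?(ltW l0)// -exprMn sqr_ge0.
  - move=> i j ri; rewrite CX /X mxE -mulmxA mxE big1 ?mulr0// => k _.
    have [kr|kr] := ltnP k r.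
      by rewrite Phz ?mul0r// /sameblk kr (leq_gtF ri) /= ri leqNgt kr.
    by rewrite mxE big1 ?mulr0// => b _; rewrite Mh0// mul0r.
exists Q, P, Ph, st; split; first split=> //.
  by move=> k /andP[_ kn]; exact: Q1.
split=> //.
- move=> i; have [sti|sti] := eqVneq (st i) 0.
    by rewrite sti !expr0n /= !mulr0 subrr addr0.
  have ir : (i < r)%N by rewrite ltnNge; apply: contra sti => /st0r ->.
  have := congr1 (fun X : 'M[R]_(d 0) => X (Ordinal (leq_trans ir (r_le (leq0n L))))
     (Ordinal (leq_trans ir (r_le (leq0n L))))) CS.
  rewrite (@mulmx_rdiagE _ _ _ _ _ _ _ _ (Ordinal (leq_trans ir (r_le (leqnn L)))))// mxE.
  rewrite CE (@mulmx_rdiagE _ _ _ _ _ _ _ _ (Ordinal (leq_trans ir (r_le (leqnSn n.+1)))))//.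
  rewrite !mxE /= !eqxx /q /p prod_layers.
  set a := \prod_(j < n.+1) _ => H.
  have a0 : a != 0.
    by apply/lt0r_neq0/prodr_gt0 => j _; rewrite invr_gt0 sqrtr_gt0 lam_gt0// leqW.
  have lE : Num.sqrt lambda = l / a.
    have := prod_invsqrt lam_gt0; rewrite big_ord_recr/= -/a -/l -/lambda => /(congr1 GRing.inv).
    by rewrite invrK invfM invrK mulrC.
  have ll : lambda = (l / a) ^+ 2.
    by rewrite -lE sqr_sqrtr// ltW// prodr_gt0// => j _; exact: lam_gt0.
  rewrite lE ll (_ : (2 * L - 1 = 2 * n.+1 + 1)%N); last by rewrite /L; lia.
  rewrite subn1 /= exprD expr1 mulnC exprM.
  move: H; set z := st i ^+ n.+1 => H.
  have l_n0 : l != 0 by rewrite gt_eqF.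
  (* Multiplied by [l * (a * a) * st i], which is nonzero, the equation becomes [l ^+ 2] times the
     diagonal entry of [CS] recorded in [H]. *)
  apply: (mulIf sti); rewrite mul0r.
  apply: (mulfI (mulf_neq0 l_n0 (mulf_neq0 a0 a0))); rewrite mulr0.
  transitivity (l ^+ 2 * (l * st i ^+ 2 + l^-1 * ((z * a) ^+ 2 * st i ^+ 2)
                          - st i * (z * a) * yr i)).
    by field; rewrite l_n0 a0.
  by rewrite -H subrr mulr0.
split.
- by rewrite WE// Q0 trmx_mul trmxK !mulmxA.
- by move=> k /andP[_ kn]; exact: WE.
under eq_rdiag => i _ _ do rewrite mulrC.
rewrite -scale_rdiag -CE /C scalerA mulVf ?gt_eqF// scale1r !mulmxA.
rewrite orthogonal_mulTK// U1 mul1mx.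
by rewrite orthogonal_mulKT//; exact: Q1.
Qed.

End Characterisation.

Unset Implicit Arguments. Set Strict Implicit. Set Printing Implicit Defensive.

(* L = n.+2 (so L >= 2); d k is the paper's d_k; lam k is the paper's
   lambda_{k+1}; W k is the paper's W_{k+1}; Q k (1 <= k <= L-1) is the
   paper's Q_{k+1} in O^{d_k}. *)
Theorem theorem2p1 (R : realType) (n : nat) (d : nat -> nat) (lam : nat -> R)
  (Y : 'M[R]_(d n.+2, d 0)) (U : 'M[R]_(d n.+2)) (V : 'M[R]_(d 0)) (y : nat -> R) :
  let L := n.+2 in
  let dmin := minn (d 0) (d L) in
  (forall k, (k < L)%N -> 0 < lam k) ->
  orthogonal_mx U -> orthogonal_mx V ->
  (forall i j, (i <= j < dmin)%N -> y j <= y i) ->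
  (forall i, (i < dmin)%N -> 0 <= y i) ->
  Y = U *m rdiag (d L) (d 0) y *m V^T ->
  (forall k, (1 <= k <= n.+1)%N -> (dmin <= d k)%N) ->
  let rY := \rank Y in
  let lambda := \prod_(k < L) lam k in
  forall W : forall k : nat, 'M[R]_(d k.+1, d k),
    critical_point lam Y W <->
    exists (Q : forall k : nat, 'M[R]_(d k)) (P : 'M[R]_(d 0)) (Ph : 'M[R]_(d L))
           (sigma : nat -> R),
      (forall k, (1 <= k <= n.+1)%N -> orthogonal_mx (Q k)) /\
      blkD_orth y rY P /\ blkD_orth y rY Ph /\
      (forall (i : 'I_(d 0)) (j : 'I_(d 0)) (i' : 'I_(d L)) (j' : 'I_(d L)),
         (i < rY)%N -> (j < rY)%N -> (i : nat) = i' -> (j : nat) = j' ->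
         P i j = Ph i' j') /\
      (forall i, (i < rY)%N ->
         sigma i ^+ (2 * L - 1) - Num.sqrt lambda * y i * sigma i ^+ (L - 1)
           + lambda * sigma i = 0 /\ 0 <= sigma i) /\
      let Sig := fun k : nat =>
        rdiag (d k.+1) (d k)
          (fun i => if (i < rY)%N then sigma i / Num.sqrt (lam k) else 0) in
      W 0%N = Q 1%N *m Sig 0%N *m P *m V^T /\
      (forall k, (1 <= k <= n)%N -> W k = Q k.+1 *m Sig k *m (Q k)^T) /\
      W n.+1 = U *m Ph^T *m Sig n.+1 *m (Q n.+1)^T.

Proof.
move=> L dmin lam_gt0 U1 V1 ymono y_ge0 YE dk rY lambda W.
have dminE : minn (d L) (d 0) = dmin by rewrite minnC.
have [] := rank_nonincreasing_svd (y := y) U1 V1; rewrite ?dminE//.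
rewrite -YE -/rY => rmin yrE.
have y_gt0 i : (i < rY)%N -> 0 < y i.
  move=> ir; have imin := leq_trans ir rmin.
  by rewrite lt0r yrE// ir y_ge0.
pose yr i := if (i < rY)%N then y i else 0.
(* Truncation changes nothing inside the matrix, since singular values from the rank on are zero. *)
have {}YE : Y = U *m rdiag (d L) (d 0) yr *m V^T.
  rewrite YE; congr (_ *m _ *m _); apply: eq_rdiag => i iL i0.
  rewrite /yr -yrE; last by rewrite /dmin leq_min iL i0.
  by case: eqP.
have r_le k : (k <= L)%N -> (rY <= d k)%N.
  move=> kL; apply: (leq_trans rmin); rewrite /dmin.
  have [->|k0] := eqVneq k 0%N; first exact: geq_minl.
  have [->|kL'] := eqVneq k L; first exact: geq_minr.
  by apply: dk; move: k0 kL kL'; rewrite /L; lia.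
have SigE (st sigma : nat -> R) k :
    (forall i, st i = if (i < rY)%N then sigma i else 0) ->
    rdiag (d k.+1) (d k) (fun i => if (i < rY)%N then sigma i / Num.sqrt (lam k) else 0) =
    rdiag (d k.+1) (d k) (fun i => st i * (Num.sqrt (lam k))^-1).
  by move=> stE; apply: eq_rdiag => i _ _; rewrite stE; case: ifP => //; rewrite mul0r.
split=> [|[Q [P [Ph [sigma [Q1 [Pb [Phb [PPh [eqn [W0 [Wk WL]]]]]]]]]]]].
  rewrite YE => /(critical_aligned_factors lam_gt0 U1 V1 y_gt0 r_le).
  move=> [Q [P [Ph [st [[Q1 Pb Phb PPh] [st_ge0 st0 eqn [W0 Wk WL]]]]]]].
  have stE i : st i = if (i < rY)%N then st i else 0.
    by case: ltnP => // /st0.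
  exists Q, P, Ph, st; split=> //; split=> //; split=> //; split=> //; split.
    by move=> i ir; split=> //; have := eqn i; rewrite ir.
  rewrite /=; split; first by rewrite (SigE st)// W0.
  by split=> [k kn|]; rewrite (SigE st)// ?Wk.
(* [sigma] is arbitrary from [rY] on; its truncation satisfies the equation at every index,
   trivially where it is 0. *)
pose st i := if (i < rY)%N then sigma i else 0.
rewrite YE; apply: (@aligned_factors_critical _ _ _ _ _ _ _ _ lam_gt0 U1 V1 y_gt0 r_le W Q P Ph st).
split=> //; split=> [i|i|i|Sig].
- by rewrite /st; case: ifP => // /eqn[].
- by rewrite /st ltnNge => ->.
- rewrite /st; case: ifP => [/eqn[]//|_].
  by rewrite !expr0n/= !mulr0 subrr addr0.
have SE k := SigE st sigma k (fun i => erefl).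
rewrite /Sig; split=> [|k kn|]; rewrite -SE//; exact: Wk.
Qed.
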